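(* Let $\mathcal H$ and $\mathcal K$ be separable Hilbert spaces, let $A$ be a bounded self-adjoint operator on $\mathcal H$, let $\mathbf B:\mathcal K\to\mathcal H$ be a Hilbert--Schmidt operator, let $I\subset\mathbb R$ be an open interval, and let $t\mapsto\Gamma(t)=\Gamma(t)^*\in B(\mathcal K)$ be a $C^1$ map (in the norm of $B(\mathcal K)$) from $I$ to the bounded self-adjoint operators on $\mathcal K$, such that $\Gamma'(t)$ is positive definite and invertible for all $t\in I$. Put $A_t=A+\mathbf B\Gamma(t)\mathbf B^*$, $t\in I$, and let $\sigma$ be an arbitrary singular Radon measure on $\mathbb R$. If $\operatorname{Ran}\mathbf B$ is cyclic for $A$, then for all $t\in I$ except maybe countably many, the spectral measure of $A_t$ is mutually singular with $\sigma$.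
   Context: Measures are non-negative Borel measures; ''singular'' means singular with respect to Lebesgue measure. ''Invertible'' means boundedly invertible. For a self-adjoint operator $A$ on $\mathcal H$ with projection-valued spectral measure $\mathbf E$, the scalar spectral measure of $\mathbf x\in\mathcal H$ is $\mu_{\mathbf x}(\cdot)=\langle \mathbf E(\cdot)\mathbf x,\mathbf x\rangle$. A vector $\mathbf x$ has maximal spectral type if $\mu_{\mathbf y}\ll\mu_{\mathbf x}$ for every $\mathbf y\in\mathcal H$. ''The spectral measure of $A$'' means a scalar spectral measure of maximal spectral type, i.e. $\mu_{\mathbf x}$ for some $\mathbf x$ of maximal spectral type; it is unique up to mutual absolute continuity. A set $S\subset\mathcal H$ is cyclic for $A$ if the smallest closed $A$-invariant subspace containing $S$ is $\mathcal H$. *)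

(* Defs.v *)
From HB Require Import structures.
From mathcomp Require Import all_boot all_order all_algebra.
From mathcomp Require Import sesquilinear.
From mathcomp Require Import complex.
From mathcomp Require Import all_classical all_reals all_analysis.

Set Implicit Arguments.
Unset Strict Implicit.
Unset Printing Implicit Defensive.

Import Order.TTheory GRing.Theory Num.Theory.
Import numFieldNormedType.Exports.

Local Open Scope classical_set_scope.
Local Open Scope complex_scope.
Local Open Scope ring_scope.

(* Complex Hilbert spaces, of arbitrary (finite or infinite) dimension.  The
   inner product is linear in its first argument; norms are R[i]-valued. *)
Record hilbert (R : realType) := Hilbert {
  hilbert_space :> completeNormedModType R[i] ;
  inner : {dot hilbert_space for @Num.conj R[i]} ;
  inner_norm : forall x : hilbert_space, inner x x = `|x| ^+ 2
}.

Notation "''[' x , y ]" := (@inner _ _ x y) : ring_scope.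

Definition separable (T : topologicalType) :=
  exists D : set T, countable D /\ dense D.

Section operators.
Context {R : realType}.
Implicit Types H K : hilbert R.

Definition self_adjoint H (T : H -> H) :=
  forall x y : H, '[T x, y] = '[x, T y].

Definition adjoint H K (T : K -> H) (Ts : H -> K) :=
  forall (x : K) (y : H), '[T x, y] = '[x, Ts y].

Definition positive_definite H (T : H -> H) :=
  forall x : H, x != 0 -> 0 < '[T x, x].

Definition boundedly_invertible H (T : H -> H) :=
  exists S : {linear H -> H}, [/\ continuous S, cancel T S & cancel S T].

(* The supremum in R of an unbounded set is 0, so this is the operator norm
   only on bounded operators. *)
Definition opnorm H K (T : K -> H) : R :=
  sup [set complex.Re `|T x| | x in [set x : K | `|x| <= 1]].

Definition C1_on H (I : set R) (G G' : R -> H -> H) :=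
  forall t, I t ->
    ((fun h => opnorm (fun x => (h^-1)%:C *: (G (t + h) x - G t x) - G' t x))
       @ 0^' --> (0 : R)) /\
    ((fun s => opnorm (fun x => G' s x - G' t x)) @ t --> (0 : R)).

Definition closed_subspace H (M : set H) :=
  [/\ closed M, M 0, (forall x y, M x -> M y -> M (x + y)) &
      forall (c : R[i]) x, M x -> M (c *: x)].

Definition cyclic H (T : H -> H) (S : set H) :=
  forall M : set H, closed_subspace M -> S `<=` M ->
    (forall x, M x -> M (T x)) -> M = setT.

Definition orthonormal_basis H (S : set H) :=
  (forall x y, S x -> S y -> '[x, y] = (x == y)%:R) /\
  (forall M : set H, closed_subspace M -> S `<=` M -> M = setT).

Definition hilbert_schmidt H K (T : K -> H) :=
  continuous T /\
  exists S : set K, orthonormal_basis S /\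
    (\esum_(e in S) (complex.Re `|T e| ^+ 2)%:E < +oo)%E.

(* Projection-valued measures on the Borel sets of R; the values of E on
   non-measurable sets are irrelevant. *)
Record pvm H (E : set (measurableTypeR R) -> {linear H -> H}) : Prop := Pvm {
  pvm_idem : forall X, measurable X -> forall x, E X (E X x) = E X x ;
  pvm_self_adjoint : forall X, measurable X -> self_adjoint (E X) ;
  pvm0 : forall x, E set0 x = 0 ;
  pvmT : forall x, E setT x = x ;
  pvmI : forall X Y, measurable X -> measurable Y ->
    forall x, E (X `&` Y) x = E X (E Y x) ;
  pvm_sigma_additive : forall F : nat -> set (measurableTypeR R),
    (forall n, measurable (F n)) -> trivIset setT F ->
    forall x, series (fun n => E (F n) x) @ \oo --> E (\bigcup_n F n) x
}.

(* As '[E X x, x] is real, taking its real part loses nothing. *)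
Definition scalar_measure H (E : set (measurableTypeR R) -> {linear H -> H})
    (x : H) : set (measurableTypeR R) -> \bar R :=
  fun X => (complex.Re '[E X x, x])%:E.

(* T = \int lambda dE(lambda), in the weak sense.  By polarization the
   quadratic forms determine the operator, H being complex. *)
Definition spectral_resolution H
    (E : set (measurableTypeR R) -> {linear H -> H}) (T : H -> H) :=
  pvm E /\
  forall x, (scalar_measure E x).-integrable setT (fun l => l%:E) /\
    '[T x, x] =
      (fine (\int[scalar_measure E x]_(l in setT) l%:E))%:C.

Definition maximal_type H (E : set (measurableTypeR R) -> {linear H -> H})
    (x : H) :=
  forall y, scalar_measure E y `<< scalar_measure E x.

(* The spectral measure is defined up to mutual absolute continuity, hence a
   predicate. *)
Definition is_spectral_measure H (T : H -> H)
    (mu : {measure set (measurableTypeR R) -> \bar R}) :=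
  exists (E : set (measurableTypeR R) -> {linear H -> H}) (x : H),
    [/\ spectral_resolution E T, maximal_type E x &
        forall X, measurable X -> mu X = scalar_measure E x X].

End operators.

Definition mutually_singular {R : realType}
    (mu nu : {measure set (measurableTypeR R) -> \bar R}) :=
  exists N, [/\ measurable N, mu N = 0%E & nu (~` N) = 0%E].

(* On R, every Borel measure that is finite on compact sets is regular. *)
Definition radon {R : realType}
    (mu : {measure set (measurableTypeR R) -> \bar R}) :=
  forall C : set R, compact C -> (mu C < +oo)%E.

(* Main.v *)
(** Write [r] for the real inner product [Re '[x, y]], [mu_f] for the scalar
    spectral measures of [A_t], and localize [sigma] to a finite measure [rho].
    If [sigma] and the spectral measure of [A_t] are not mutually singular, then
    by Hahn decomposition and cyclicity there is [f_t] with [mu_(f_t) <= rho] and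
    [B^* f_t != 0].  Then [k_t(X) = B^* E_t(X) f_t] is a [K]-valued measure with
    a density in [L^2(rho; K)], because [B] is Hilbert-Schmidt.  For [X] in an
    interval of length [l], comparing [A_t E_t(X) f_t] and [A_s E_s(X) f_s] with
    the same multiple of the identity gives
      [|r((Gamma_t - Gamma_s) k_t(X), k_s(X))| <= 2 l rho(X)].
    As [rho] lives on a Lebesgue null set, which is covered by intervals of
    arbitrarily small total length, the densities satisfy
      [\int r((Gamma_t - Gamma_s) k_t, k_s) drho = 0].
    Were there uncountably many such [t], separability of [L^2(rho; K)] would
    give [t_n -> s] with [k_(t_n) -> k_s] weakly; dividing by [t_n - s] and
    passing to the limit, [\int r(Gamma'_s k_s, k_s) drho = 0], contradicting the
    positivity of [Gamma'_s].  Densities are avoided by working with sums over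
    finite partitions. *)
From HB Require Import structures.
Require Import Defs.
From mathcomp Require Import all_boot all_order all_algebra.
From mathcomp Require Import sesquilinear finmap.
From mathcomp Require Import complex.
From mathcomp Require Import all_classical all_reals all_analysis.
From mathcomp Require Import measurable_realfun ring lra.

Set Implicit Arguments.
Unset Strict Implicit.
Unset Printing Implicit Defensive.

Import Order.TTheory GRing.Theory Num.Theory.
Import numFieldNormedType.Exports.

Local Open Scope classical_set_scope.
Local Open Scope complex_scope.
Local Open Scope ring_scope.

(** * The real inner product *)

Section real_inner_product.
Context {R : realType}.

Lemma ReD (a b : R[i]) : complex.Re (a + b) = complex.Re a + complex.Re b.
Proof. by case: a; case: b. Qed.

Lemma ReN (a : R[i]) : complex.Re (- a) = - complex.Re a.
Proof. by case: a. Qed.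

Lemma ReJ (a : R[i]) : complex.Re (Num.conj a) = complex.Re a.
Proof. by case: a. Qed.

(** The inner product of the underlying real Hilbert space: it induces the same norm, and its real
    values keep the estimates within reach of [lra] and [nra]. *)
Definition rip (H : hilbert R) (x y : H) : R := complex.Re '[x, y].

Variable H : hilbert R.
Implicit Types x y z : H.

Lemma ripDl x y z : rip (x + y) z = rip x z + rip y z.
Proof. by rewrite /rip linearDl ReD. Qed.

Lemma ripDr x y z : rip z (x + y) = rip z x + rip z y.
Proof. by rewrite /rip linearDr ReD. Qed.

Lemma ripNl x z : rip (- x) z = - rip x z.
Proof. by rewrite /rip linearNl ReN. Qed.

Lemma ripNr x z : rip z (- x) = - rip z x.
Proof. by rewrite /rip linearNr ReN. Qed.

Lemma ripBl x y z : rip (x - y) z = rip x z - rip y z.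
Proof. by rewrite ripDl ripNl. Qed.

Lemma ripBr x y z : rip z (x - y) = rip z x - rip z y.
Proof. by rewrite ripDr ripNr. Qed.

Lemma rip0l z : rip 0 z = 0.
Proof. by rewrite /rip linear0l. Qed.

Lemma rip0r z : rip z 0 = 0.
Proof. by rewrite /rip linear0r. Qed.

Lemma ripC x y : rip x y = rip y x.
Proof.
by rewrite /rip hermC expr0 mul1r; apply: ReJ.
Qed.

Lemma ripZl (c : R) x y : rip (c%:C *: x) y = c * rip x y.
Proof.
rewrite /rip linearZl_LR /=; case: '[x, y] => a b /=.
by rewrite mul0r subr0.
Qed.

Lemma ripZr (c : R) x y : rip x (c%:C *: y) = c * rip x y.
Proof. by rewrite ripC ripZl ripC. Qed.

Lemma rip_norm x : `|x| ^+ 2 = (rip x x)%:C.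
Proof.
rewrite -inner_norm /rip RRe_real //.
by apply: ger0_real; rewrite inner_norm exprn_ge0.
Qed.

Lemma rip_ge0 x : 0 <= rip x x.
Proof. by rewrite -lecR -rip_norm exprn_ge0. Qed.

Lemma rip_eq0 x : (rip x x == 0) = (x == 0).
Proof.
by rewrite -(inj_eq (@complexI R)) -rip_norm sqrf_eq0 normr_eq0.
Qed.

Lemma normE x : `|x| = (Num.sqrt (rip x x))%:C.
Proof.
apply/eqP; rewrite -(eqrXn2 (n := 2)) //; last by rewrite lecR sqrtr_ge0.
by rewrite rip_norm -rmorphXn /= sqr_sqrtr // rip_ge0.
Qed.

Lemma rip_cs x y : rip x y ^+ 2 <= rip x x * rip y y.
Proof.
have [y0|y0] := eqVneq (rip y y) 0.
  have /eqP -> : y == 0 by rewrite -rip_eq0 y0.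
  by rewrite !rip0r expr0n mulr0.
have yp : 0 < rip y y by rewrite lt0r y0 rip_ge0.
(* This squared norm equals [rip y y] times the defect of the inequality. *)
have := rip_ge0 ((rip y y)%:C *: x - (rip x y)%:C *: y).
rewrite !(ripDl, ripDr, ripNl, ripNr, ripZl, ripZr) (ripC y x) => h.
rewrite -subr_ge0 -(pmulr_rge0 _ yp); nra.
Qed.

Lemma rip_cs_sqrt x y : `|rip x y| <= Num.sqrt (rip x x) * Num.sqrt (rip y y).
Proof. by rewrite -sqrtrM ?rip_ge0 // -sqrtr_sqr ler_wsqrtr // rip_cs. Qed.

Lemma rip_suml I (r : seq I) (P : pred I) (F : I -> H) z :
  rip (\sum_(i <- r | P i) F i) z = \sum_(i <- r | P i) rip (F i) z.
Proof. by elim/big_rec2: _ => [|i y a _ <-]; rewrite ?rip0l // ripDl. Qed.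

Lemma rip_sumr I (r : seq I) (P : pred I) (F : I -> H) z :
  rip z (\sum_(i <- r | P i) F i) = \sum_(i <- r | P i) rip z (F i).
Proof. by rewrite ripC rip_suml; apply: eq_bigr => i _; rewrite ripC. Qed.

Lemma cvg_ripl (u : nat -> H) x y : u @ \oo --> x ->
  (fun n => rip (u n) y) @ \oo --> rip x y.
Proof.
move=> /cvgrPdist_le ux; apply/cvgrPdist_le => e e0.
have p0 : 0 < Num.sqrt (rip y y) + 1 by rewrite ltr_wpDl // sqrtr_ge0.
have /ux : 0 < (e / (Num.sqrt (rip y y) + 1))%:C by rewrite ltcR divr_gt0.
apply: filterS => n; rewrite normE lecR -ripBl => h.
rewrite (le_trans (rip_cs_sqrt _ _)) // (le_trans (ler_wpM2r _ h)) ?sqrtr_ge0 //.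
by rewrite mulrAC ler_pdivrMr // ler_pM2l // lerDl.
Qed.

End real_inner_product.

(** * Projection-valued measures *)

Section spectral_measures.
Context {R : realType}.
Variables (H : hilbert R) (E : set (measurableTypeR R) -> {linear H -> H}).
Hypothesis pE : pvm E.
Implicit Types (x y z : H) (X Y : set (measurableTypeR R)).

Lemma pvm_rip X x y : measurable X -> rip (E X x) y = rip x (E X y).
Proof. by move=> mX; rewrite /rip (pvm_self_adjoint pE). Qed.

Lemma pvm_rip_idem X x y : measurable X ->
  rip (E X x) (E X y) = rip (E X x) y.
Proof. by move=> mX; rewrite -pvm_rip // (pvm_idem pE). Qed.

Lemma pvm_ge0 X x : measurable X -> 0 <= rip (E X x) x.
Proof. by move=> mX; rewrite -pvm_rip_idem // rip_ge0. Qed.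

Lemma pvm_rip_sigma (F : nat -> set (measurableTypeR R)) x y :
  (forall n, measurable (F n)) -> trivIset setT F ->
  (fun n => \sum_(0 <= i < n) rip (E (F i) x) y) @ \oo -->
    rip (E (\bigcup_n F n) x) y.
Proof.
move=> mF tF; have /(cvg_ripl (y := y)) := pvm_sigma_additive pE mF tF (x := x).
apply: cvg_trans.
by apply: near_eq_cvg; near=> n; rewrite /series /= rip_suml.
Unshelve. all: by end_near. Qed.

(* [scalar_measure] is not a measure on non-measurable sets. *)
Definition rscalar x X : \bar R :=
  if `[< measurable X >] then (rip (E X x) x)%:E else 0%E.

Lemma rscalarE x X : measurable X -> rscalar x X = (rip (E X x) x)%:E.
Proof. by move=> mX; rewrite /rscalar asboolT. Qed.

Let rscalar0 x : rscalar x set0 = 0%E.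
Proof. by rewrite rscalarE // (pvm0 pE) rip0l. Qed.

Let rscalar_ge0 x X : (0 <= rscalar x X)%E.
Proof. by rewrite /rscalar; case: asboolP => // mX; rewrite lee_fin pvm_ge0. Qed.

Let rscalar_sigma x : semi_sigma_additive (rscalar x).
Proof.
move=> F mF tF mUF; rewrite rscalarE //.
have -> : (fun n => \sum_(0 <= i < n) rscalar x (F i))%E =
    (fun n => (\sum_(0 <= i < n) rip (E (F i) x) x)%:E).
  by apply/funext => n; rewrite -sumEFin; apply: eq_bigr => i _; rewrite rscalarE.
by apply: cvg_EFin; [exact: nearW | exact: pvm_rip_sigma].
Qed.

HB.instance Definition _ x := isMeasure.Build _ _ _ (rscalar x)
  (rscalar0 x) (@rscalar_ge0 x) (@rscalar_sigma x).

Import HBNNSimple.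

(** An integral is built from suprema over simple functions, whose level sets are measurable; there
    the two set functions agree. *)
Lemma rscalar_integral x (D : set (measurableTypeR R)) f :
  (\int[scalar_measure E x]_(l in D) f l = \int[rscalar x]_(l in D) f l)%E.
Proof.
have e (h : {nnsfun measurableTypeR R >-> R}) :
    sintegral (scalar_measure E x) h = sintegral (rscalar x) h.
  by apply: eq_fsbigr => r _; rewrite rscalarE.
by rewrite /integral; congr (ereal_sup _ - ereal_sup _)%E;
  apply: eq_imagel => h _; exact: e.
Qed.

(** Countable additivity for the sequence [X], [Y], [set0], [set0], ..., tested against the defect
    [u] itself, shows that [u] has norm 0. *)
Lemma pvmU X Y x : measurable X -> measurable Y -> [disjoint X & Y] ->
  E (X `|` Y) x = E X x + E Y x.
Proof.
move=> mX mY /disj_set2P XY.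
apply/eqP; rewrite -subr_eq0 -rip_eq0.
set u := E (X `|` Y) x - _.
have : rip u u = 0.
  rewrite {1}/u ripBl ripDl; apply/eqP; rewrite subr_eq0; apply/eqP.
  rewrite -bigcup2E.
  have m2 n : measurable (bigcup2 X Y n) by case: n => [|[|n]] //=.
  have t2 : trivIset setT (bigcup2 X Y) by rewrite -trivIset_bigcup2.
  have h := pvm_rip_sigma (x := x) (y := u) m2 t2.
  apply: (cvg_unique _ h) => //.
  apply: cvg_near_cst; near=> n.
  have n2 : (2 <= n)%N by near: n; exact: nbhs_infty_ge.
  rewrite -(subnKC n2) big_mkord big_split_ord /= !big_ord_recl big_ord0 addr0 /=.
  by rewrite big1 ?addr0 // => i _; rewrite (pvm0 pE) rip0l.
by move/eqP.
Unshelve. all: by end_near. Qed.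

Lemma pvmC X x : measurable X -> E (~` X) x = x - E X x.
Proof.
move=> mX; rewrite -{2}(pvmT pE x) -(setvU X) setUC pvmU //; first last.
  by apply/disj_set2P; rewrite setICr.
  exact: measurableC.
by rewrite addrC addKr.
Qed.

Lemma pvm_le X x : measurable X -> rip (E X x) (E X x) <= rip x x.
Proof.
move=> mX; rewrite pvm_rip_idem //.
have := pvm_ge0 x (measurableC mX).
by rewrite pvmC // ripBl subr_ge0.
Qed.

Variable T : H -> H.
Hypothesis TD : {morph T : x y / x + y}.
Hypothesis Tsa : forall x y, rip (T x) y = rip x (T y).
Hypothesis ET : spectral_resolution E T.

Lemma rscalar_integrable x : (rscalar x).-integrable setT (fun l => l%:E).
Proof.
have [/integrableP[_ + _]] := ET.2 x.
rewrite rscalar_integral => h.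
by apply/integrableP; split => //; exact: EFin_measurable.
Qed.

Lemma rscalar_quad x :
  rip (T x) x = fine (\int[rscalar x]_l l%:E)%E.
Proof. by have [_ h] := ET.2 x; rewrite /rip h /= rscalar_integral. Qed.

(* Then [mu_(x+y) = mu_x + mu_y], so the quadratic form of [T] is additive on
   the pair [x], [y]. *)
Lemma pvm_orthogonal x y :
  (forall X, measurable X -> rip (E X x) y = 0) -> rip (T x) y = 0.
Proof.
move=> h.
have e X : measurable X ->
    rscalar (x + y) X = measure_add (rscalar x) (rscalar y) X.
  move=> mX; rewrite measure_addE /= !rscalarE //; congr EFin.
  have -> : E X (x + y) = E X x + E X y by exact: linearD.
  rewrite !(ripDl, ripDr) h // [rip (E X y) x]pvm_rip // [rip y _]ripC h //.
  by rewrite addr0 add0r.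
have : rip (T (x + y)) (x + y) = rip (T x) x + rip (T y) y.
  rewrite !rscalar_quad.
  rewrite (eq_measure_integral (measure_add (rscalar x) (rscalar y))); last first.
    by move=> A mA _; exact: e.
  rewrite integral_measure_add //; try exact: rscalar_integrable.
  by rewrite fineD //; exact: integrable_fin_num (rscalar_integrable _).
rewrite TD !(ripDl, ripDr) [rip (T y) x]Tsa [rip y _]ripC.
by lra.
Qed.

(** The measure [rscalar x] is carried by [X], where the integrand lies between [a] and [b]. *)
Lemma spectral_quad_bound x X (a b : R) : measurable X -> X `<=` `[a, b] ->
  E X x = x -> a * rip x x <= rip (T x) x <= b * rip x x.
Proof.
move=> mX Xab EX.
have nC : rscalar x (~` X) = 0%E.
  by rewrite rscalarE ?pvmC ?EX ?subrr ?rip0l //; exact: measurableC.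
have nX : rscalar x X = (rip x x)%:E by rewrite rscalarE // EX.
have iX : (rscalar x).-integrable X (fun l => l%:E).
  by apply: integrableS (rscalar_integrable x).
have ci (c : R) : (rscalar x).-integrable X (cst c%:E).
  apply/integrableP; split; first exact: measurable_cst.
  by rewrite -[X in (integral _ _ X)]/(cst `|c|%:E) integral_cst //= nX -EFinM ltry.
have e : (\int[rscalar x]_l l%:E = \int[rscalar x]_(l in X) l%:E)%E.
  rewrite (negligible_integral (N := ~` X)) //; [|exact: measurableC|exact: rscalar_integrable].
  by rewrite setTD setCK.
have fi : (\int[rscalar x]_l l%:E)%E \is a fin_num.
  exact: integrable_fin_num (rscalar_integrable _).
have h1 : (\int[rscalar x]_(l in X) cst a%:E l <= \int[rscalar x]_(l in X) l%:E)%E.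
  apply: le_integral => // l; rewrite inE => /Xab /=.
  by rewrite in_itv /= lee_fin => /andP[].
have h2 : (\int[rscalar x]_(l in X) l%:E <= \int[rscalar x]_(l in X) cst b%:E l)%E.
  apply: le_integral => // l; rewrite inE => /Xab /=.
  by rewrite in_itv /= lee_fin => /andP[].
rewrite rscalar_quad -!lee_fin fineK // e.
by move: h1 h2; rewrite !integral_cst //= nX -!EFinM => -> ->.
Qed.

(** Replacing [y] by its projection [E X y] changes neither term on the left. Both vectors then lie
    in the range of [E X], where the form of [T - a] is between 0 and [b - a], and polarization with
    [x + y'] and [x - y'] gives the bound. *)
Lemma spectral_bilin_bound x y X (a b : R) : a <= b -> measurable X -> X `<=` `[a, b] ->
  E X x = x ->
  `|rip (T x) y - a * rip x y| <= (b - a) * ((rip x x + rip y y) / 2).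
Proof.
move=> lab mX Xab Ex; set y' := E X y.
have Ey : E X y' = y' by rewrite (pvm_idem pE).
have o z : rip z (y - y') = rip (z - E X z) y.
  by rewrite ripBr ripBl -pvm_rip.
(* Every [E Y x] is fixed by [E X], hence orthogonal to [y - y']. *)
have Txy : rip (T x) y = rip (T x) y'.
  apply/eqP; rewrite -subr_eq0 -ripBr; apply/eqP; apply: pvm_orthogonal => Y mY.
  by rewrite o -(pvmI pE) // setIC (pvmI pE) // Ex subrr rip0l.
have xy : rip x y = rip x y'.
  by apply/eqP; rewrite -subr_eq0 -ripBr o Ex subrr rip0l.
have yy : rip y' y' <= rip y y by exact: pvm_le.
have q1 := spectral_quad_bound (x := x + y') mX Xab.
have q2 := spectral_quad_bound (x := x - y') mX Xab.
have {q1}/andP[q1 q1'] := q1 (etrans (linearD _ _ _) (congr2 _ Ex Ey)).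
have {q2}/andP[q2 q2'] := q2 (etrans (linearB _ _ _) (congr2 (fun u v => u - v) Ex Ey)).
have T0 : T 0 = 0 by apply: (addIr (T 0)); rewrite -TD addr0 add0r.
have TB : T (- y') = - T y'.
  by apply/eqP; rewrite -subr_eq0 opprK -TD addNr T0.
move: q1 q1' q2 q2'; rewrite !TD TB !(ripDl, ripDr, ripNl, ripNr) Txy xy.
rewrite [rip (T y') x]Tsa [rip y' (T x)]ripC [rip y' x]ripC.
have := rip_ge0 (x - y'); have := rip_ge0 (x + y').
rewrite !(ripDl, ripDr, ripNl, ripNr) [rip y' x]ripC.
move: yy lab.
move: (rip x x) (rip y' y') (rip y y) (rip x y') (rip (T x) x) (rip (T x) y') (rip (T y') y').
move=> xx yy y2 p qx qxy qyy *.
by rewrite ler_norml; apply/andP; split; nra.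
Qed.

End spectral_measures.

(** * Bessel, Parseval and Hilbert-Schmidt operators *)

Section bessel.
Context {R : realType}.
Variable H : hilbert R.

Lemma innerZl (c : R[i]) (x y : H) : '[c *: x, y] = c * '[x, y].
Proof. exact: linearZl_LR. Qed.

Lemma innerZr (c : R[i]) (x y : H) : '[x, c *: y] = Num.conj c * '[x, y].
Proof. exact: linearZr_LR. Qed.

Lemma innerBl (x y z : H) : '[x - y, z] = '[x, z] - '[y, z].
Proof. exact: linearBl. Qed.

Lemma innerDl (x y z : H) : '[x + y, z] = '[x, z] + '[y, z].
Proof. exact: linearDl. Qed.

Lemma rip_iZr (x y : H) : rip x ('i%C *: y) = complex.Im '[x, y].
Proof.
rewrite /rip innerZr /=.
have -> (a b : R[i]) : complex.Re (Num.conj a * b) =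
   complex.Re a * complex.Re b + complex.Im a * complex.Im b.
  by case: a => a a'; case: b => b b' /=; rewrite mulNr opprK.
by rewrite /= mul0r add0r mul1r.
Qed.

Lemma Re_sqr_norm (c : R[i]) : (complex.Re (`|c| ^+ 2))%:C = `|c| ^+ 2.
Proof. by apply: RRe_real; apply: ger0_real; exact: exprn_ge0. Qed.

Lemma Re_sqr_norm_ge0 (c : R[i]) : 0 <= complex.Re (`|c| ^+ 2).
Proof. by rewrite -lecR Re_sqr_norm; exact: exprn_ge0. Qed.

Lemma ripZZ (c : R[i]) (x : H) :
  rip (c *: x) (c *: x) = complex.Re (`|c| ^+ 2) * rip x x.
Proof.
apply: (@complexI R); rewrite -rip_norm normrZ exprMn rip_norm.
by rewrite -Re_sqr_norm rmorphM.
Qed.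

Lemma rip_add2 (x y : H) : rip (x + y) (x + y) <= 2 * rip x x + 2 * rip y y.
Proof.
have := rip_ge0 (x - y).
rewrite !(ripDl, ripDr, ripNl, ripNr) (ripC y x); lra.
Qed.

Definition sqn (x : H) : R := rip x x.

(** Expand the squared norm of [v - \sum_i a i *: y i] with [a i = rip (y i) v / w i]. Because [w i]
    dominates the squared norm of [y i], the quadratic term is at most the left-hand sum [S], so
    [0 <= rip v v - 2 S + S]. *)
Lemma bessel (I : finType) (y : I -> H) (w : I -> R) (v : H) :
  (forall i j, i != j -> rip (y i) (y j) = 0) ->
  (forall i, rip (y i) (y i) <= w i) ->
  \sum_i rip (y i) v ^+ 2 / w i <= rip v v.
Proof.
move=> yo yw.
pose a i := rip (y i) v / w i.
have w0 i : 0 <= w i by rewrite (le_trans (rip_ge0 _) (yw i)).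
have := rip_ge0 (v - \sum_i (a i)%:C *: y i).
rewrite ripBl !ripBr [rip v (\sum__ _)]ripC.
have -> : rip (\sum_i (a i)%:C *: y i) v = \sum_i rip (y i) v ^+ 2 / w i.
  rewrite rip_suml; apply: eq_bigr => i _.
  by rewrite ripZl /a expr2 mulrAC.
have : rip (\sum_i (a i)%:C *: y i) (\sum_i (a i)%:C *: y i) <=
   \sum_i rip (y i) v ^+ 2 / w i.
  rewrite rip_suml; apply: ler_sum => i _.
  rewrite rip_sumr (bigD1 i) //= big1 ?addr0; last first.
    by move=> j ji; rewrite ripZl ripZr yo ?mulr0 // eq_sym.
  rewrite ripZl ripZr /a.
  have [->|wi] := eqVneq (w i) 0; first by rewrite invr0 !mulr0 mul0r.
  have wp : 0 < w i by rewrite lt0r wi w0.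
  apply: (@le_trans _ _ (rip (y i) v / w i * (rip (y i) v / w i * w i))).
    by rewrite mulrA [leRHS]mulrA ler_wpM2l // -expr2 sqr_ge0.
  by rewrite mulfVK // expr2 mulrAC.
lra.
Qed.

End bessel.

Lemma sqnZ (R : realType) (K : hilbert R) (c : R) (x : K) :
  sqn (c%:C *: x) = c ^+ 2 * sqn x.
Proof. by rewrite /sqn ripZl ripZr mulrA -expr2. Qed.

Lemma sqnB_le (R : realType) (K : hilbert R) (x y : K) :
  sqn (x - y) <= 2 * sqn x + 2 * sqn y.
Proof. by have := rip_add2 x (- y); rewrite [rip (- y) _]ripNl ripNr opprK. Qed.

Section approximation.
Context {R : realType}.
Variable H : hilbert R.

Lemma rip_sqr_le (x : H) (e : R) : 0 <= e -> (`|x| <= e%:C) = (rip x x <= e ^+ 2).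
Proof.
move=> e0; rewrite normE lecR -[in RHS](sqr_sqrtr (rip_ge0 x)) ler_sqr //.
by rewrite nnegrE sqrtr_ge0.
Qed.

Lemma closure_rip (M : set H) z (e : R) : closure M z -> 0 < e ->
  exists2 w, M w & rip (z - w) (z - w) <= e.
Proof.
move=> cM e0.
have /cM[w [Mw]] : nbhs z (ball z (Num.sqrt e)%:C).
  by apply: nbhsx_ballx; rewrite ltcR sqrtr_gt0.
rewrite -ball_normE /= => /ltW zw; exists w => //.
by move: zw; rewrite rip_sqr_le ?sqrtr_ge0 // sqr_sqrtr // ltW.
Qed.

End approximation.

Section parseval.
Context {R : realType}.
Variables (H : hilbert R) (S : set H).
Hypothesis oS : forall x y, S x -> S y -> '[x, y] = (x == y)%:R.
Implicit Types (F : {fset H}) (x y z : H).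

Definition fproj F z : H := \sum_(e <- F) '[z, e] *: e.
Definition fdist F z := rip (z - fproj F z) (z - fproj F z).

Lemma fproj_inner F z e : [set` F] `<=` S -> e \in F -> '[fproj F z, e] = '[z, e].
Proof.
move=> FS eF; rewrite /fproj linear_sumlz /=.
rewrite (big_fsetD1 e) //= innerZl /= (oS (FS _ eF) (FS _ eF)) eqxx mulr1.
rewrite big_seq big1 ?addr0 // => x; rewrite !inE => /andP[xe xF].
by rewrite innerZl /= (oS (FS _ xF) (FS _ eF)) (negbTE xe) mulr0.
Qed.

Lemma fproj_orth F z y : [set` F] `<=` S -> rip (z - fproj F z) (fproj F y) = 0.
Proof.
move=> FS; rewrite {2}/fproj rip_sumr big_seq big1 // => e eF.
by rewrite /rip innerZr /= innerBl fproj_inner // subrr mulr0.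
Qed.

(** This is the squared modulus of ['[z, e]], split into real and imaginary parts so that the real
    Bessel inequality applies to each. *)
Definition fsqr z e := rip z e ^+ 2 + rip z ('i%C *: e) ^+ 2.

Lemma fdistE F z : [set` F] `<=` S ->
  rip z z = fdist F z + \sum_(e <- F) fsqr z e.
Proof.
move=> FS; have -> : \sum_(e <- F) fsqr z e = rip z (fproj F z).
  rewrite rip_sumr; apply: eq_bigr => e _.
  rewrite /fsqr rip_iZr /rip innerZr /=.
  by case: '[z, e] => a b /=; rewrite mulNr opprK !expr2.
rewrite /fdist [in rip (z - _) _]ripBr fproj_orth // subr0 ripBl ripC.
by rewrite -addrA addNr addr0.
Qed.

Lemma fsqr_ge0 z e : 0 <= fsqr z e.
Proof. by rewrite addr_ge0 // sqr_ge0. Qed.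

Lemma fdist_le F z : [set` F] `<=` S -> fdist F z <= rip z z.
Proof. by move=> FS; rewrite (fdistE z FS) lerDl sumr_ge0 // => e _; exact: fsqr_ge0. Qed.

Lemma fdist_mono F F' z : [set` F'] `<=` S -> (F `<=` F')%fset ->
  fdist F' z <= fdist F z.
Proof.
move=> FS' FF'; have FS : [set` F] `<=` S.
  by move=> e /= /(fsubsetP FF') /FS'.
have := fdistE z FS; rewrite (fdistE z FS').
have : \sum_(e <- F) fsqr z e <= \sum_(e <- F') fsqr z e.
  pose g e := if e \in F then fsqr z e else 0.
  have -> : \sum_(e <- F) fsqr z e = \sum_(e <- F) g e.
    by apply: eq_big_seq => e eF; rewrite /g eF.
  rewrite (big_fset_incl _ FF') /=; last by move=> e _; rewrite /g => /negbTE ->.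
  by apply: ler_sum => e _; rewrite /g; case: ifP => // _; exact: fsqr_ge0.
lra.
Qed.

Lemma fprojD F x y : fproj F (x + y) = fproj F x + fproj F y.
Proof.
rewrite /fproj -big_split /=; apply: eq_bigr => e _.
by rewrite innerDl scalerDl.
Qed.

Lemma fprojZ F c x : fproj F (c *: x) = c *: fproj F x.
Proof.
rewrite /fproj scaler_sumr; apply: eq_bigr => e _.
by rewrite innerZl scalerA.
Qed.

Lemma fdistD F x y : fdist F (x + y) <= 2 * fdist F x + 2 * fdist F y.
Proof.
by rewrite /fdist fprojD opprD addrACA rip_add2.
Qed.

Lemma fdistZ F c x : fdist F (c *: x) = complex.Re (`|c| ^+ 2) * fdist F x.
Proof. by rewrite /fdist fprojZ -scalerBr ripZZ. Qed.

Hypothesis cS : forall M : set H, closed_subspace M -> S `<=` M -> M = setT.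

(** The vectors that can be so approximated form a closed subspace containing [S], hence
    everything. *)
Lemma parseval_fdist z (e : R) : 0 < e ->
  exists2 F : {fset H}, [set` F] `<=` S & fdist F z <= e.
Proof.
pose M := [set z | forall e : R, 0 < e ->
  exists2 F : {fset H}, [set` F] `<=` S & fdist F z <= e].
suff MT : M = setT by have /(_ e) : M z by rewrite MT.
apply: cS; last first.
  move=> x Sx e0 e0p; exists [fset x]%fset; first by move=> y /=; rewrite inE => /eqP ->.
  have := fdistE (F := [fset x]%fset) x; rewrite big_seq_fset1 /fdist /fproj.
  rewrite big_seq_fset1 oS // eqxx scale1r subrr rip0l => _; exact: ltW.
split.
- move=> x cM e0 e0p.
  have e4 : 0 < e0 / 4 by rewrite divr_gt0.
  have [w Mw xw] := closure_rip cM e4.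
  have [F FS Fw] := Mw _ e4; exists F => //.
  have := fdistD F (x - w) w; rewrite subrK.
  have := fdist_le (x - w) FS; lra.
- move=> e0 e0p; exists fset0; first by move=> y /=; rewrite inE.
  by rewrite /fdist /fproj big_seq_fset0 subrr rip0l ltW.
- move=> x y Mx My e0 e0p.
  have e4 : 0 < e0 / 4 by rewrite divr_gt0.
  have [F FS Fx] := Mx _ e4; have [F' FS' Fy] := My _ e4.
  exists (F `|` F')%fset.
    by move=> u /=; rewrite inE => /orP[/FS|/FS'].
  have UF : [set` (F `|` F')%fset] `<=` S.
    by move=> u /=; rewrite inE => /orP[/FS|/FS'].
  have := fdistD (F `|` F')%fset x y.
  have := fdist_mono x UF (fsubsetUl F F').
  have := fdist_mono y UF (fsubsetUr F F'); lra.
- move=> c x Mx e0 e0p.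
  set k := complex.Re (`|c| ^+ 2).
  have k0 : 0 <= k by exact: Re_sqr_norm_ge0.
  have [|F FS Fx] := Mx (e0 / (k + 1)); first by rewrite divr_gt0 // ltr_wpDl.
  exists F => //; rewrite fdistZ -/k.
  apply: (@le_trans _ _ (k * (e0 / (k + 1)))); first by rewrite ler_wpM2l.
  by rewrite mulrCA ger_pMr // ler_pdivrMr ?mul1r ?lerDl // ltr_wpDl.
Qed.

(** Allowing every larger [F'] lets finitely many vectors share one finite set. *)
Lemma parseval_le z (e : R) : 0 < e -> exists2 F : {fset H}, [set` F] `<=` S &
  forall F' : {fset H}, [set` F'] `<=` S -> (F `<=` F')%fset ->
    rip z z <= \sum_(u <- F') fsqr z u + e.
Proof.
move=> e0; have [F FS Fz] := parseval_fdist z e0; exists F => // F' FS' FF'.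
by rewrite (fdistE z FS') addrC lerD2l (le_trans (fdist_mono z FS' FF')).
Qed.

End parseval.

Section hilbert_schmidt_bound.
Context {R : realType}.
Variables (H K : hilbert R) (B : {linear K -> H}) (Bs : {linear H -> K}).
Hypotheses (hsB : hilbert_schmidt B) (adjB : adjoint B Bs).

Lemma rip_adj x y : rip (Bs x) y = rip x (B y).
Proof. by rewrite ripC [RHS]ripC /rip adjB. Qed.

(** Parseval expands each [Bs (y i)] over the basis; after exchanging the sums, Bessel for the
    family [y] bounds the terms of a basis vector [u] by twice the squared norm of [B u]. With
    [y i = E (Y i) f] and [w i = rho (Y i)] this replaces the existence of a density in
    [L^2(rho; K)]. *)
Lemma hilbert_schmidt_bound : exists2 C : R, 0 < C &
  forall (I : finType) (y : I -> H) (w : I -> R),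
  (forall i j, i != j -> rip (y i) (y j) = 0) ->
  (forall i, rip (y i) (y i) <= w i) ->
  \sum_i rip (Bs (y i)) (Bs (y i)) / w i <= C.
Proof.
have [_ [S [[oS cS] hS]]] := hsB.
pose h := fine (\esum_(e in S) (complex.Re `|B e| ^+ 2)%:E)%E.
have hge (F : {fset K}) : [set` F] `<=` S -> \sum_(e <- F) rip (B e) (B e) <= h.
  move=> FS; rewrite -lee_fin /h fineK; last first.
    by rewrite ge0_fin_numE // esum_ge0 // => e _; rewrite lee_fin sqr_ge0.
  apply: esum_ge; exists [set` F]; first by split => //; exact: finite_fset.
  rewrite -fsbig_seq ?fset_uniq // -sumEFin; apply: lee_sum => e _.
  by rewrite lee_fin normE /= sqr_sqrtr // rip_ge0.
have h0 : 0 <= h by apply: fine_ge0; apply: esum_ge0 => e _; rewrite lee_fin sqr_ge0.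
exists (2 * h + 1); first by rewrite ltr_wpDl // mulr_ge0.
move=> I y w yo yw.
have w0 i : 0 <= w i by rewrite (le_trans (rip_ge0 _) (yw i)).
pose W := \sum_i (w i)^-1.
have W0 : 0 <= W by apply: sumr_ge0 => i _; rewrite invr_ge0.
(* The Parseval errors, weighted by the [(w i)^-1], add up to [W / (W + 1) <= 1], the extra 1 in the
   constant. *)
have e0 : 0 < (W + 1)^-1 by rewrite invr_gt0 ltr_wpDl.
have /choice[F FP] : forall i, exists F : {fset K}, [set` F] `<=` S /\
  forall F' : {fset K}, [set` F'] `<=` S -> (F `<=` F')%fset ->
    rip (Bs (y i)) (Bs (y i)) <= \sum_(u <- F') fsqr (Bs (y i)) u + (W + 1)^-1.
  by move=> i; have [F] := parseval_le oS cS (Bs (y i)) e0; exists F.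
pose G := (\bigcup_(i in I) F i)%fset.
have GS : [set` G] `<=` S.
  by move=> u /= /bigfcupP[i _ uF]; exact: (FP i).1.
have FG i : (F i `<=` G)%fset by apply/fsubsetP => u uF; apply/bigfcupP; exists i; rewrite ?mem_index_enum.
apply: (@le_trans _ _ (\sum_i (\sum_(u <- G) fsqr (Bs (y i)) u / w i + (W + 1)^-1 / w i))).
  apply: ler_sum => i _; rewrite -mulr_suml -mulrDl ler_wpM2r ?invr_ge0 //.
  exact: (FP i).2.
rewrite big_split /= lerD //; last first.
  by rewrite -mulr_sumr -/W mulrC ler_pdivrMr ?mul1r ?lerDl // ltr_wpDl.
rewrite exchange_big /= (le_trans _ (ler_wpM2l _ (hge _ GS))) // mulr_sumr.
apply: ler_sum => u _; rewrite /fsqr.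
under eq_bigr do rewrite mulrDl.
rewrite big_split /= mulrDl mul1r.
apply: lerD.
  by under eq_bigr do rewrite rip_adj; exact: bessel.
under eq_bigr do rewrite rip_adj.
apply: (le_trans (bessel _ yo yw)).
have -> : B ('i%C *: u) = 'i%C *: B u by exact: linearZ.
by rewrite ripZZ normCi expr1n mul1r.
Qed.

End hilbert_schmidt_bound.

(** * Covers of null sets and condensation points *)

(** Lebesgue measure is the outer measure defined by countable covers with half-open intervals; take
    a cover that is optimal up to [e]. *)
Lemma lebesgue_null_cover (R : realType) (Z : set (measurableTypeR R)) (e : R) :
  lebesgue_measure Z = 0%E -> 0 < e ->
  exists a b : nat -> R, [/\ (forall k, a k <= b k),
    Z `<=` \bigcup_k `]a k, b k]%classic &
    forall n, \sum_(k < n) (b k - a k) <= e].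
Proof.
move=> Z0 e0.
have : (lebesgue_measure Z : \bar R) \is a fin_num by rewrite Z0.
move=> /(lb_ereal_inf_adherent e0) [_ /= [A [mA ZA] <-]].
rewrite -[ereal_inf _]/(lebesgue_measure Z) Z0 add0e => Ae.
have /choice[ab abE] : forall k, exists x : R * R, x.1 <= x.2 /\
    A k `<=` `]x.1, x.2]%classic /\ wlength idfun (A k) = (x.2 - x.1)%:E.
  move=> k; have [x _ xA] := mA k; rewrite -xA.
  have [x12|x21] := leP x.1 x.2.
    by exists x; split => //; split => //; rewrite wlength_itv_bnd.
  (* An interval with its ends in the wrong order is empty; it gets equal ends to keep
     [a k <= b k]. *)
  exists (x.1, x.1) => /=; split=> //; split.
    by rewrite set_itv_ge // bnd_simp -leNgt ltW.
  by rewrite set_itv_ge ?wlength0 ?subrr // bnd_simp -leNgt ltW.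
exists (fst \o ab), (snd \o ab); split.
- by move=> k; case: (abE k).
- by move=> z /ZA[k _ Az]; exists k => //; case: (abE k) => _ [+ _]; exact.
- move=> n; rewrite -lee_fin -sumEFin (le_trans _ (ltW Ae)) //.
  have -> : (\sum_(i < n) ((snd \o ab) i - (fst \o ab) i)%:E =
      \sum_(0 <= i < n) wlength idfun (A i))%E.
    by rewrite big_mkord; apply: eq_bigr => i _; case: (abE i) => _ [_ ->].
  by apply: nneseries_lim_ge => k _ _; exact: wlength_ge0.
Qed.

(* [W n i k] is the [k]-th cell of a countable cover of [T] by sets that are
   [1/(n+1)]-small for the [i]-th of countably many pseudometrics. *)
Lemma condensation (T : Type) (P : set T) (W : nat -> nat -> nat -> set T) :
  (forall n i x, exists k, W n i k x) -> ~ countable P ->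
  exists2 s, P s & forall n, exists t, [/\ P t, t <> s &
    forall i, (i <= n)%N -> exists k, W n i k s /\ W n i k t].
Proof.
move=> WP; apply: contra_notP => /forall2NP h.
have /choice[f fP] : forall s, exists n, P s -> forall t, P t ->
    (forall i, (i <= n)%N -> exists k, W n i k s /\ W n i k t) -> t = s.
  move=> s; have [//|/existsNP[n nP]] := h s; first by exists 0%N.
  exists n => Ps t Pt st; apply: contrapT => ts; apply: nP; exists t; split => //.
have /choice[g gP] : forall p : nat * nat * T, exists k, W p.1.1 p.1.2 k p.2.
  by move=> p; exact: WP.
(* At level [f s] no other point of [P] shares all cells with [s], so that level and the indices of
   these finitely many cells determine [s]. *)
pose code s := (f s, [seq g (f s, i, s) | i <- iota 0 (f s).+1]).
apply/countable_injP; exists (choice.pickle \o code) => s t.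
rewrite !inE => Ps Pt /= /(pcan_inj choice.pickleK) st.
have fst_ : f s = f t := congr1 fst st.
have /eq_in_map gst : [seq g (f s, i, s) | i <- iota 0 (f s).+1] =
    [seq g (f s, i, t) | i <- iota 0 (f s).+1].
  by have := congr1 snd st; rewrite /code -fst_.
apply: esym; apply: (fP _ Ps _ Pt) => i ile.
exists (g (f s, i, s)); split; first exact: (gP (f s, i, s)).
rewrite gst ?mem_iota ?add0n ?ltnS //; exact: (gP (f s, i, t)).
Qed.

(** * Vector measures dominated by a finite measure *)

Section finite_measure.
Context {R : realType}.
Variable rho : {measure set (measurableTypeR R) -> \bar R}.
Hypothesis rho_fin : (rho setT < +oo)%E.
Implicit Types X Y : set (measurableTypeR R).

Definition rmass X : R := fine (rho X).

Lemma rmass_fin X : measurable X -> rho X \is a fin_num.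
Proof.
move=> mX; rewrite ge0_fin_numE //; apply: le_lt_trans rho_fin.
by apply: le_measure; rewrite ?inE.
Qed.

Lemma rmass_ge0 X : 0 <= rmass X.
Proof. by apply: fine_ge0. Qed.

Lemma rmassU X Y : measurable X -> measurable Y -> [disjoint X & Y] ->
  rmass (X `|` Y) = rmass X + rmass Y.
Proof.
move=> mX mY /disj_set2P XY.
by rewrite /rmass measureU // fineD // rmass_fin.
Qed.

Lemma rmass_capP (F : nat -> set (measurableTypeR R)) (e : R) :
  (forall n, measurable (F n)) -> (forall n, F n.+1 `<=` F n) ->
  rho (\bigcap_n F n) = 0%E -> 0 < e ->
  exists N, forall n, (N <= n)%N -> rmass (F n) <= e.
Proof.
move=> mF dF F0 e0.
have ni : nonincreasing_seq F by apply/nonincreasing_seqP => n; exact/subsetPset.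
have mcap : measurable (\bigcap_n F n) by exact: bigcap_measurable.
have : rho \o F @ \oo --> 0%E.
  rewrite -F0; apply: nonincreasing_cvg_mu => //.
  by rewrite (le_lt_trans _ rho_fin) // le_measure ?inE.
move=> /fine_cvgP [_ /cvgrPdist_le /(_ _ e0) [N _ NP]].
exists N => n /NP; rewrite sub0r normrN ger0_norm //.
exact: rmass_ge0.
Qed.

End finite_measure.

Section dominated.
Context {R : realType}.
Variable (K : hilbert R) (rho : {measure set (measurableTypeR R) -> \bar R}).
Hypothesis rho_fin : (rho setT < +oo)%E.
Implicit Types (X Y : set (measurableTypeR R)) (k : set (measurableTypeR R) -> K).
Local Notation r := (rmass rho).

(* The measures with a density in [L^2(rho; K)] of norm at most [sqrt C]; the
   second clause makes [k] vanish on null sets, so [/ r (Y i)] is harmless when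
   [r (Y i) = 0]. *)
Definition l2_bounded (C : R) k :=
  [/\ forall X Y, measurable X -> measurable Y -> [disjoint X & Y] ->
        k (X `|` Y) = k X + k Y,
      forall X, measurable X -> sqn (k X) <= C * r X &
      forall (I : finType) (Y : I -> set (measurableTypeR R)),
        (forall i, measurable (Y i)) -> (forall i j, i != j -> [disjoint (Y i) & (Y j)]) ->
        \sum_i sqn (k (Y i)) / r (Y i) <= C].

(** A countable pi-system generating the Borel sets: the condensation argument controls only
    countably many quantities. *)
Definition rational_rays : set (set (measurableTypeR R)) :=
  [set `]ratr q, +oo[%classic | q in [set: rat]].

Lemma rational_rays_measurable :
  @measurable _ (measurableTypeR R) = <<s rational_rays >>.
Proof.
apply/seteqP; split.
  rewrite RGenOInfty.measurableE; apply: smallest_sub.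
    exact: smallest_sigma_algebra.
  move=> _ [x ->].
  have -> : `]x, +oo[%classic = \bigcup_(q : rat)
      (if x < ratr q then `](ratr q : R), +oo[%classic else set0).
    apply/seteqP; split => y /=; rewrite in_itv /= andbT.
      move=> /rat_in_itvoo[q]; rewrite in_itv /= => /andP[xq qy].
      by exists q => //; rewrite xq /= in_itv /= qy.
    move=> [q _]; case: ifP => // xq; rewrite /= in_itv /= andbT.
    exact: lt_trans.
  apply: (@bigcupT_measurable_rat _ (g_sigma_algebraType rational_rays)) => q.
  case: ifP => _; last exact: measurable0.
  by apply: sub_sigma_algebra; exists q.
apply: smallest_sub; first exact: sigma_algebra_measurable.
by move=> _ [q _ <-]; exact: measurable_itv.
Qed.

Lemma rational_rays_setI : setI_closed rational_rays.
Proof.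
move=> _ _ [p _ <-] [q _ <-]; have [pq|qp] := leP p q.
  exists q => //; apply/seteqP; split => y /=; rewrite !in_itv /= !andbT.
    by move=> qy; split=> //; apply: le_lt_trans qy; rewrite ler_rat.
  by case.
exists p => //; apply/seteqP; split => y /=; rewrite !in_itv /= !andbT.
  by move=> py; split=> //; apply: lt_trans py; rewrite ltr_rat.
by case.
Qed.

(** One-sided, as it is applied to nonnegative sequences, for which it means convergence to 0. *)
Definition nullseq (u : nat -> R) :=
  forall e : R, 0 < e -> exists N, forall n, (N <= n)%N -> u n <= e.

Lemma nullseqD2 (u v w : nat -> R) : nullseq u -> nullseq v ->
  (forall n, w n <= 2 * u n + 2 * v n) -> nullseq w.
Proof.
move=> u0 v0 uvw e e0; have e4 : 0 < e / 4 by rewrite divr_gt0.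
have [N Nu] := u0 _ e4; have [M Mv] := v0 _ e4.
exists (maxn N M) => n; rewrite geq_max => /andP[/Nu un /Mv vn].
have := uvw n; lra.
Qed.

Lemma l2_bounded0 C k : l2_bounded C k -> k set0 = 0.
Proof.
move=> [_ kC _]; have := kC _ measurable0.
rewrite /rmass measure0 mulr0 => h; apply/eqP; rewrite -rip_eq0.
by rewrite eq_le h rip_ge0.
Qed.

(** Dynkin's pi-lambda argument. For a countable disjoint union, the tails have small [rho]-mass,
    and the second clause of [l2_bounded] makes their contribution small uniformly in [n]. *)
Lemma l2_bounded_cvg (C : R) (k : nat -> set (measurableTypeR R) -> K) k0 :
  0 < C -> (forall n, l2_bounded C (k n)) -> l2_bounded C k0 ->
  nullseq (fun n => sqn (k n setT - k0 setT)) ->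
  (forall q : rat, nullseq (fun n =>
    sqn (k n `]ratr q, +oo[%classic - k0 `]ratr q, +oo[%classic))) ->
  forall X, measurable X -> nullseq (fun n => sqn (k n X - k0 X)).
Proof.
move=> C0 kb k0b kT kr X; rewrite [measurable]rational_rays_measurable.
pose P X := nullseq (fun n => sqn (k n X - k0 X)).
have PU X1 X2 : measurable X1 -> measurable X2 -> [disjoint X1 & X2] ->
    P X1 -> P X2 -> P (X1 `|` X2).
  move=> m1 m2 d12 P1 P2; apply: nullseqD2 P1 P2 _ => n.
  have [kD _ _] := kb n; have [k0D _ _] := k0b.
  by rewrite kD // k0D // opprD addrACA; exact: rip_add2.
move: X; apply: (@dynkin_induction _ (measurableTypeR R) rational_rays P).
- exact: rational_rays_measurable.
- exact: rational_rays_setI.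
- exact: kT.
- by move=> _ [q _ <-]; exact: kr.
- move=> X mX PX; apply: nullseqD2 kT PX _ => n.
  have mC := measurableC mX.
  have d : [disjoint X & ~` X] by apply/disj_set2P; rewrite setICr.
  have [kD _ _] := kb n; have [k0D _ _] := k0b.
  have -> : k n (~` X) = k n setT - k n X by rewrite -(setvU X) setUC kD // addrC addKr.
  have -> : k0 (~` X) = k0 setT - k0 X by rewrite -(setvU X) setUC k0D // addrC addKr.
  have -> : k n setT - k n X - (k0 setT - k0 X) = (k n setT - k0 setT) + - (k n X - k0 X).
    by rewrite !opprB addrACA [RHS]addrACA [- k n X + _]addrC.
  apply: (le_trans (rip_add2 _ _)).
  by rewrite /sqn ripNl ripNr opprK.
- move=> F mF tF PF.
  pose V m := \big[setU/set0]_(i < m) F i.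
  have mV m : measurable (V m) by apply: bigsetU_measurable.
  have PV m : P (V m).
    elim: m => [|m IH].
      rewrite /V big_ord0 => e e0; exists 0%N => n _.
      by rewrite (l2_bounded0 (kb n)) (l2_bounded0 k0b) subr0 /sqn rip0l ltW.
    rewrite /V big_ord_recr /=; apply: PU => //; first exact: mV.
    apply/disj_set2P; rewrite -subset0 => x [].
    rewrite -bigcup_mkord => -[i /= im Fi] Fm.
    have := tF i m I I (ex_intro _ x (conj Fi Fm)).
    by move: im => /[swap] ->; rewrite ltnn.
  set U := \bigcup_k F k; have mU : measurable U by exact: bigcup_measurable.
  pose G m := U `\` V m.
  have mG m : measurable (G m) by exact: measurableD.
  have G0 : \bigcap_m G m = set0.
    rewrite -subset0 => x Gx; have [[i _ Fi] _] := Gx 0%N I.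
    have [_] := Gx i.+1 I; apply; rewrite /V -bigcup_mkord; exists i => //=.
  have dG m : G m.+1 `<=` G m.
    by move=> x [Ux nV]; split => // Vx; apply: nV; rewrite /V big_ord_recr; left.
  have UE m : U = V m `|` G m.
    rewrite /G setDE setUIr setUv setIT; apply/esym/setUidPr.
    by rewrite /V -bigcup_mkord => x [i _ Fi]; exists i.
  have dVG m : [disjoint V m & G m].
    by apply/disj_set2P; rewrite /G setDE setICA setICr setI0.
  move=> e e0.
  (* Each of the two tails then has square at most [e / 16]; with [e / 4] for the finite part, [2 *
     (e / 4) + 2 * (2 * (e / 16) + 2 * (e / 16)) = e]. *)
  have e1 : 0 < e / (16 * C) by rewrite divr_gt0 // mulr_gt0.
  have [|m mP] := rmass_capP rho_fin mG dG _ e1; first by rewrite G0 measure0.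
  have {mP} Gm := mP m (leqnn m).
  have e4 : 0 < e / 4 by rewrite divr_gt0.
  have [N NP] := PV m _ e4; exists N => n /NP Vn.
  have [kD kC _] := kb n; have [k0D k0C _] := k0b.
  rewrite (UE m) kD // k0D // opprD addrACA.
  apply: (le_trans (rip_add2 _ _)); rewrite -/(sqn _).
  have := rip_add2 (k n (G m)) (- k0 (G m)); rewrite ripNl ripNr opprK.
  have := kC _ (mG m); have := k0C _ (mG m).
  have : C * r (G m) <= e / 16.
    rewrite ler_pdivlMr // (_ : C * r (G m) * 16 = r (G m) * (16 * C)); last by ring.
    by rewrite -ler_pdivlMr // mulr_gt0.
  move: Vn; rewrite /sqn; lra.
Qed.

End dominated.

(** * Commutators over a singular measure *)

Section finitely_additive.
Context {R : realType} {V : zmodType}.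
Implicit Types X Y : set (measurableTypeR R).

Definition finitely_additive (f : set (measurableTypeR R) -> V) :=
  forall X Y, measurable X -> measurable Y -> [disjoint X & Y] ->
    f (X `|` Y) = f X + f Y.

Lemma finitely_additive0 f : finitely_additive f -> f set0 = 0.
Proof.
move=> fD.
have d0 : [disjoint (set0 : set (measurableTypeR R)) & set0].
  by apply/disj_set2P; rewrite set0I.
have := fD _ _ measurable0 measurable0 d0.
by rewrite setU0 => h; apply: (addIr (f set0)); rewrite add0r -h.
Qed.

Lemma finitely_additive_sum f (I : finType) (Y : I -> set (measurableTypeR R)) :
  finitely_additive f -> (forall i, measurable (Y i)) ->
  (forall i j, i != j -> [disjoint (Y i) & (Y j)]) ->
  f (\bigcup_i Y i) = \sum_i f (Y i).
Proof.
move=> fD mY dY.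
suff h (s : seq I) : uniq s ->
    measurable (\bigcup_(i in [set` s]) Y i) /\
    f (\bigcup_(i in [set` s]) Y i) = \sum_(i <- s) f (Y i).
  have [_ <-] := h _ (index_enum_uniq I); congr f.
  by apply/seteqP; split => x [i _ Yx]; exists i => //=; rewrite mem_index_enum.
elim: s => [|i s IH] /=.
  move=> _; rewrite set_nil bigcup_set0 big_nil finitely_additive0 //.
move=> /andP[si us]; have [ms fs] := IH us.
have -> : \bigcup_(j in [set` i :: s]) Y j = Y i `|` \bigcup_(j in [set` s]) Y j.
  apply/seteqP; split => x /=.
    by move=> [j /=]; rewrite inE => /predU1P[->|js] Yx; [left|right; exists j].
  move=> [Yx|[j js Yx]]; first by exists i => //=; rewrite inE eqxx.
  by exists j => //=; rewrite inE js orbT.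
split; first exact: measurableU.
rewrite big_cons fD ?fs //; apply/disj_set2P; rewrite -subset0 => x [Yi [j /= js Yj]].
have /dY /disj_set2P ij : i != j by apply: contraNneq si => ->.
have : (Y i `&` Y j) x by [].
by rewrite ij.
Qed.

End finitely_additive.

Section singular_commutator.
Context {R : realType}.
Variable (K : hilbert R) (rho : {measure set (measurableTypeR R) -> \bar R}).
Hypothesis rho_fin : (rho setT < +oo)%E.
Local Notation T := (measurableTypeR R).
Local Notation r := (rmass rho).
Implicit Types k : set T -> K.

(** Cells may be empty or null, so that a common refinement is indexed by the whole product
    [I * J]. *)
Record splitting (I : finType) (Y : I -> set T) : Prop := Splitting {
  splitting_meas : forall i, measurable (Y i) ;
  splitting_disj : forall i j, i != j -> [disjoint (Y i) & (Y j)] ;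
  splitting_cover : \bigcup_i Y i = setT }.

(** For [k] with density [h], this is the squared norm in [L^2(rho; K)] of the conditional
    expectation of [h] on [Y]; null cells contribute 0. *)
Definition energy k (I : finType) (Y : I -> set T) : R :=
  \sum_i sqn (k (Y i)) / r (Y i).

Lemma l2_bounded_null C k X : l2_bounded rho C k -> measurable X ->
  r X = 0 -> k X = 0.
Proof.
move=> [_ kC _] mX X0; apply/eqP; rewrite -rip_eq0 eq_le rip_ge0 andbT.
by have := kC _ mX; rewrite X0 mulr0.
Qed.

Lemma l2_bounded_split C k (I : finType) (Y : I -> set T) (X : set T) :
  l2_bounded rho C k -> splitting Y -> measurable X ->
  k X = \sum_i k (X `&` Y i).
Proof.
move=> [kD _ _] [mY dY cY] mX.
rewrite -(@finitely_additive_sum _ _ k) //.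
- by rewrite -setI_bigcupr cY setIT.
- by move=> i; exact: measurableI.
- move=> i j /dY /disj_set2P ij; apply/disj_set2P.
  by rewrite setIACA ij setI0.
Qed.

Lemma rmass_split (I : finType) (Y : I -> set T) (X : set T) :
  splitting Y -> measurable X -> r X = \sum_i r (X `&` Y i).
Proof.
move=> [mY dY cY] mX.
rewrite -(@finitely_additive_sum _ _ r) //.
- by rewrite -setI_bigcupr cY setIT.
- by move=> A B; exact: rmassU.
- by move=> i; exact: measurableI.
- move=> i j /dY /disj_set2P ij; apply/disj_set2P.
  by rewrite setIACA ij setI0.
Qed.

Lemma splittingI (I J : finType) (Y : I -> set T) (X : J -> set T) :
  splitting Y -> splitting X -> splitting (fun p : I * J => Y p.1 `&` X p.2).
Proof.
move=> [mY dY cY] [mX dX cX]; split.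
- by move=> p; exact: measurableI.
- move=> [i j] [i' j'] /=; rewrite xpair_eqE negb_and => /orP[/dY|/dX] /disj_set2P h;
    by apply/disj_set2P; rewrite setIACA h ?set0I ?setI0.
- apply/seteqP; split => // x _.
  have [i _ Yx] : (\bigcup_i Y i) x by rewrite cY.
  have [j _ Xx] : (\bigcup_i X i) x by rewrite cX.
  by exists (i, j).
Qed.

(* Conditional expectation on [Y] is an orthogonal projection in [L^2(rho; K)]. *)
Lemma energy_defect C k (I J : finType) (Y : I -> set T) (X : J -> set T) :
  l2_bounded rho C k -> splitting Y -> splitting X ->
  \sum_(p : I * J) sqn (k (Y p.1 `&` X p.2) -
      (r (Y p.1 `&` X p.2))%:C *: ((r (Y p.1))^-1%:C *: k (Y p.1))) /
      r (Y p.1 `&` X p.2) =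
  energy k (fun p : I * J => Y p.1 `&` X p.2) - energy k Y.
Proof.
move=> kb sY sX; have mY := splitting_meas sY; have mX := splitting_meas sX.
have mYX i j : measurable (Y i `&` X j) by exact: measurableI.
have e (i : I) (j : J) (v : K) :
  sqn (k (Y i `&` X j) - (r (Y i `&` X j))%:C *: v) / r (Y i `&` X j) =
  sqn (k (Y i `&` X j)) / r (Y i `&` X j) -
    2 * rip (k (Y i `&` X j)) v + r (Y i `&` X j) * sqn v.
  have [z|nz] := eqVneq (r (Y i `&` X j)) 0.
    rewrite z (l2_bounded_null kb (mYX i j) z) scale0r subr0 /sqn !rip0l.
    by rewrite !mul0r mulr0 subrr addr0.
  rewrite /sqn !(ripDl, ripDr, ripNl, ripNr, ripZl, ripZr) [rip v (k _)]ripC.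
  by field.
rewrite (eq_bigr _ (fun p _ => e p.1 p.2 ((r (Y p.1))^-1%:C *: k (Y p.1)))) /= /energy.
rewrite !big_split /= -addrA; congr (_ + _).
rewrite -(pair_bigA _ (fun i j => - (2 * rip (k (Y i `&` X j))
  ((r (Y i))^-1%:C *: k (Y i))))) /=.
rewrite -(pair_bigA _ (fun i j => r (Y i `&` X j) *
  sqn ((r (Y i))^-1%:C *: k (Y i)))) /=.
rewrite -big_split /= -sumrN; apply: eq_bigr => i _.
rewrite sumrN -mulr_sumr -rip_suml -mulr_suml.
rewrite -(l2_bounded_split kb sX (mY i)) -(rmass_split sX (mY i)).
have [z|nz] := eqVneq (r (Y i)) 0.
  by rewrite (l2_bounded_null kb (mY i) z) z /sqn !rip0l mul0r !mulr0 mul0r addr0.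
rewrite /sqn !ripZr ripZl; field => //.
Qed.

(* Convexity of [x |-> '[L x, x]]. *)
Lemma energy_convex C k (L : {linear K -> K}) (I : finType) (Y : I -> set T) :
  l2_bounded rho C k -> splitting Y -> (forall x, 0 <= rip (L x) x) ->
  0 < r setT ->
  rip (L (k setT)) (k setT) / r setT <=
    \sum_i rip (L (k (Y i))) (k (Y i)) / r (Y i).
Proof.
move=> kb sY L0 rT; have mY := splitting_meas sY.
have LZ (c : R) x : L (c%:C *: x) = c%:C *: L x by exact: linearZ.
have LB x y : L (x - y) = L x - L y by exact: linearB.
(* On a cell of positive mass this is [r (Y i)] times the form of [L] at the mean of [k] over [Y i]
   minus [m]. Below, [m] is the mean over the whole line. *)
have key (m : K) i : 0 <= rip (L (k (Y i))) (k (Y i)) / r (Y i) -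
    (rip (L (k (Y i))) m + rip (L m) (k (Y i))) + r (Y i) * rip (L m) m.
  have [z|nz] := eqVneq (r (Y i)) 0.
    rewrite (l2_bounded_null kb (mY i) z) z.
    have -> : L 0 = 0 by exact: linear0.
    by rewrite !rip0l rip0r !mul0r !addr0 subrr.
  have := L0 ((r (Y i))^-1%:C *: k (Y i) - m).
  rewrite LB LZ !(ripDl, ripDr, ripNl, ripNr, ripZl, ripZr) => h.
  have rp : 0 <= r (Y i) by exact: rmass_ge0.
  apply: le_trans (mulr_ge0 rp h) _; rewrite le_eqVlt; apply/orP; left; apply/eqP.
  by field.
pose m := (r setT)^-1%:C *: k setT.
have : 0 <= \sum_i (rip (L (k (Y i))) (k (Y i)) / r (Y i) -
    (rip (L (k (Y i))) m + rip (L m) (k (Y i))) + r (Y i) * rip (L m) m).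
  by apply: sumr_ge0 => i _; exact: key.
have kT : k setT = \sum_i k (Y i).
  rewrite (l2_bounded_split kb sY measurableT).
  by apply: eq_bigr => i _; rewrite setTI.
have rTE : r setT = \sum_i r (Y i).
  rewrite (rmass_split sY measurableT).
  by apply: eq_bigr => i _; rewrite setTI.
have LkT : L (k setT) = \sum_i L (k (Y i)) by rewrite kT; exact: linear_sum.
rewrite !big_split /= sumrN big_split /= -rip_suml -rip_sumr -mulr_suml.
rewrite -LkT -kT -rTE /m LZ !(ripZl, ripZr).
set q := rip (L (k setT)) (k setT); set s := \sum_i _.
have -> : r setT * ((r setT)^-1 * ((r setT)^-1 * q)) = q / r setT.
  by field; rewrite gt_eqF.
rewrite [_^-1 * q]mulrC; lra.
Qed.

Lemma energy_le C k (I : finType) (Y : I -> set T) :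
  l2_bounded rho C k -> splitting Y -> energy k Y <= C.
Proof. by move=> [_ _ kE] [mY dY _]; exact: kE. Qed.

(* [energy k] increases under refinement and is bounded: take a near-supremum. *)
Lemma near_optimal_splitting C k (e : R) : l2_bounded rho C k -> 0 < e ->
  exists (I : finType) (Y : I -> set T), splitting Y /\
    forall (J : finType) (X : J -> set T), splitting X ->
      energy k (fun p : I * J => Y p.1 `&` X p.2) - energy k Y <= e.
Proof.
move=> kb e0.
pose S := [set x | exists (I : finType) (Y : I -> set T), splitting Y /\ x = energy k Y].
have ubS : ubound S C by move=> _ [I [Y [sY ->]]]; exact: energy_le.
have hS : has_sup S.
  split; last by exists C.
  exists (energy k (fun _ : unit => setT)), unit, (fun=> setT); split => //.
  split; [by move=> _; exact: measurableT | by move=> [] [] |].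
  by apply/seteqP; split => // x _; exists tt.
have [_ [I [Y [sY ->]]] eY] := sup_adherent e0 hS.
exists I, Y; split => // J X sX.
have : energy k (fun p : I * J => Y p.1 `&` X p.2) <= sup S.
  apply: sup_upper_bound => //; exists (I * J)%type, (fun p => Y p.1 `&` X p.2).
  by split => //; exact: splittingI.
lra.
Qed.

Lemma sum_option (J : finType) (f : option J -> R) :
  \sum_o f o = f None + \sum_j f (Some j).
Proof.
rewrite (bigD1 None) //=; congr (_ + _).
rewrite (reindex_omap (op := +%R) Some id) //=.
  by apply: eq_bigl => j; rewrite eqxx.
by case.
Qed.

Lemma splitting_seqDU (F : nat -> set T) m : (forall j, measurable (F j)) ->
  splitting (fun o : option 'I_m =>
    if o is Some j then seqDU F j else ~` \big[setU/set0]_(j < m) F j).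
Proof.
move=> mF; have mD j : measurable (seqDU F j).
  by apply: measurableD => //; exact: bigsetU_measurable.
have h (j : 'I_m) : seqDU F j `<=` \big[setU/set0]_(j < m) F j.
  by move=> x [Fx _]; rewrite -bigcup_mkord; exists j => /=.
split.
- by case => // ; apply: measurableC; exact: bigsetU_measurable.
- move=> [i|] [j|] //= ij; apply/disj_set2P.
  + have /trivIsetP/(_ i j I I) := trivIset_seqDU F; apply.
    by apply: contra ij => /eqP/val_inj ->.
  + by rewrite -subset0 => x [/h].
  + by rewrite -subset0 => x [+ /h].
- apply/seteqP; split => // x _.
  have [Fx|nFx] := pselect ((\big[setU/set0]_(j < m) F j) x); last by exists None.
  move: Fx; rewrite bigsetU_seqDU -bigcup_mkord => -[j jm Fx].
  by exists (Some (Ordinal jm)).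
Qed.

(* On [X `<=` `[p j, q j]] the form of [D] is at most [c * (q j - p j) * r X], and
   these intervals have small total length; the part of the partition outside
   of the first [m] intervals has small mass.  Replacing [k0] by its conditional
   expectation on [Y] costs [eta], by near-optimality of [Y]. *)
Lemma singular_commutator_estimate (C M c eta e1 : R) (Z : set T)
    (k k0 : set T -> K) (L : {linear K -> K}) (D : K -> K)
    (I : finType) (Y : I -> set T) :
  0 < C -> 0 <= M -> 0 <= c -> 0 < eta -> 0 <= e1 ->
  lebesgue_measure Z = 0%E -> rho (~` Z) = 0%E -> measurable Z ->
  l2_bounded rho C k -> l2_bounded rho C k0 -> splitting Y ->
  (forall x y a, 0 < a -> `|rip (L x) y| <= M * (a * sqn x + sqn y / a)) ->
  (forall x y, `|rip (D x) y - rip (L x) y| <= e1 * (sqn x + sqn y)) ->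
  (forall (a b : R) (X : set T), a <= b -> measurable X -> X `<=` `[a, b] ->
    `|rip (D (k X)) (k0 X)| <= c * (b - a) * r X) ->
  (forall (J : finType) (X : J -> set T), splitting X ->
      energy k0 (fun p : I * J => Y p.1 `&` X p.2) - energy k0 Y <= eta ^+ 2) ->
  \sum_i rip (L (k (Y i))) ((r (Y i))^-1%:C *: k0 (Y i)) <=
    2 * C * e1 + M * eta * (C + 1).
Proof.
move=> C0 M0 c0 eta0 e10 Z0 rZ mZ kb k0b sY LM DL Dc Ydef.
pose v i := (r (Y i))^-1%:C *: k0 (Y i).
apply/ler_addgt0Pr => e e0; rewrite -/v.
have e3 : 0 < e / 3 by rewrite divr_gt0.
pose V := \sum_i sqn (v i).
have V0 : 0 <= V by apply: sumr_ge0 => i _; exact: rip_ge0.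
pose n : R := #|I|%:R.
have n0 : 0 <= n by [].
(* Total length of the cover: each of the [n] cells of [Y] meets all intervals, at a cost of at most
   [n * c * d <= e / 3]. *)
pose d := e / 3 / (c * n + 1).
have d0 : 0 < d by rewrite divr_gt0 // ltr_wpDl // mulr_ge0.
(* The weight in Young's inequality on the remainder, so large that [M * V / a <= e / 3]; the mass
   of the remainder is then chosen small relative to [a]. *)
pose a := (M * V + 1) / (e / 3).
have a0 : 0 < a by rewrite divr_gt0 // ltr_wpDl // mulr_ge0.
have Va : M * (V / a) <= e / 3.
  rewrite mulrA ler_pdivrMr // [leRHS]mulrC /a divfK ?gt_eqF //.
  by rewrite lerDl.
have [p [q [pq Zpq dpq]]] := lebesgue_null_cover Z0 d0.
pose F j : set T := `]p j, q j]%classic.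
have mF j : measurable (F j) by exact: measurable_itv.
have MaC : 0 < M * a * C + 1.
  by apply: ltr_wpDl => //; apply: mulr_ge0; [apply: mulr_ge0 => //|]; exact: ltW.
have g0 : 0 < e / 3 / (M * a * C + 1) by rewrite divr_gt0.
pose Rm m := ~` \big[setU/set0]_(j < m) F j.
have [m mP] : exists m, r (Rm m) <= e / 3 / (M * a * C + 1).
  have [|||N NP] := rmass_capP rho_fin (F := Rm) _ _ _ g0.
  - by move=> m; apply: measurableC; exact: bigsetU_measurable.
  - by move=> m; apply: subsetC; rewrite big_ord_recr /=; exact: subsetUl.
  - have sub : \bigcap_m Rm m `<=` ~` Z.
      move=> x Rx Zx; have [j _ Fx] := Zpq _ Zx.
      have nF : ~ (\big[setU/set0]_(i < j.+1) F i) x := Rx j.+1 Logic.I.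
      by apply: nF; rewrite -bigcup_mkord; exists j => /=.
    apply/eqP; rewrite eq_le measure_ge0 andbT -rZ; apply: le_measure => //.
      rewrite inE; apply: bigcap_measurable => // m _.
      by apply: measurableC; exact: bigsetU_measurable.
    by rewrite inE; exact: measurableC.
  by exists N; exact: NP.
pose X (o : option 'I_m) := if o is Some j then seqDU F j else Rm m.
have sX : splitting X by exact: splitting_seqDU.
have sYX := splittingI sY sX.
pose B (w : I * option 'I_m) := Y w.1 `&` X w.2.
have mB w : measurable (B w) by exact: (splitting_meas sYX).
have mYi i : measurable (Y i) by exact: (splitting_meas sY).
(* [u] is the deviation of [k0] from its conditional expectation on [Y]. [G] collects the cost of
   [u] and of replacing [D] by [L], and [E] the cost of the intervals and of the remainder. *)
pose u w := k0 (B w) - (r (B w))%:C *: v w.1.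
pose G w := (e1 * (sqn (k (B w)) + sqn (k0 (B w))) +
  M * (eta * sqn (k (B w)) + sqn (u w) / eta)) / r (B w).
pose E (w : I * option 'I_m) := if w.2 is Some j then c * (q j - p j)
  else M * (a * (C * r (B w)) + sqn (v w.1) / a).
(* On a cell inside an interval, the left side times [r (B w)] is the form with [k0 (B w)] minus
   that with [u w]. On the remainder, Young's inequality suffices. *)
have term w : rip (L (k (B w))) (v w.1) <= G w + E w.
  have rB : 0 <= r (B w) by exact: rmass_ge0.
  have G0 : 0 <= G w.
    rewrite divr_ge0 // addr_ge0 // mulr_ge0 // addr_ge0 ?rip_ge0 //.
      by rewrite mulr_ge0 ?rip_ge0 // ltW.
    by rewrite divr_ge0 ?rip_ge0 // ltW.
  case: w rB G0 => i [j|] rB G0 /=; last first.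
    apply: (@le_trans _ _ (E (i, None))); last by rewrite lerDr.
    apply: (le_trans (ler_norm _)); apply: (le_trans (LM _ _ a a0)).
    rewrite ler_wpM2l // lerD2r ler_wpM2l ?(ltW a0) //.
    by have [_ kC _] := kb; exact: kC.
  have E0 : 0 <= E (i, Some j) by rewrite mulr_ge0 // subr_ge0.
  have [z|nz] := eqVneq (r (B (i, Some j))) 0.
    rewrite (l2_bounded_null kb (mB _) z).
    have -> : L 0 = 0 by exact: linear0.
    by rewrite rip0l addr_ge0.
  have rp : 0 < r (B (i, Some j)) by rewrite lt0r nz.
  have Bsub : B (i, Some j) `<=` `[p j, q j].
    move=> x [_ [+ _]]; rewrite /F /= !in_itv /= => /andP[/ltW -> ->] //.
  have h1 := Dc _ _ _ (pq j) (mB (i, Some j)) Bsub.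
  have h2 := DL (k (B (i, Some j))) (k0 (B (i, Some j))).
  have h3 := LM (k (B (i, Some j))) (u (i, Some j)) _ eta0.
  rewrite -(ler_pM2r rp) mulrDl /G divfK //.
  have ue : rip (L (k (B (i, Some j)))) (u (i, Some j)) =
    rip (L (k (B (i, Some j)))) (k0 (B (i, Some j))) -
    rip (L (k (B (i, Some j)))) (v i) * r (B (i, Some j)).
    by rewrite /u ripBr ripZr [_ * r _]mulrC.
  move: h1 h2 h3; rewrite !ler_norml => /andP[_ h1] /andP[h2 _] /andP[h3 _].
  move: h3; rewrite ue.
  have -> : E (i, Some j) = c * (q j - p j) by [].
  lra.
have -> : \sum_i rip (L (k (Y i))) (v i) = \sum_w rip (L (k (B w))) (v w.1).
  rewrite -(pair_bigA _ (fun i o => rip (L (k (B (i, o)))) (v i))) /=.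
  apply: eq_bigr => i _; rewrite -rip_suml; congr (rip _ _).
  by rewrite (l2_bounded_split kb sX (mYi i)); exact: linear_sum.
apply: (le_trans (ler_sum _ (fun w _ => term w))).
rewrite big_split /=; apply: lerD.
  have e1k : \sum_w sqn (k (B w)) / r (B w) <= C by exact: (energy_le kb sYX).
  have e1k0 : \sum_w sqn (k0 (B w)) / r (B w) <= C by exact: (energy_le k0b sYX).
  have e1u : \sum_w sqn (u w) / r (B w) <= eta ^+ 2.
    by have := energy_defect k0b sY sX; rewrite -/B => ->; exact: Ydef.
  have -> : \sum_w G w = e1 * (\sum_w sqn (k (B w)) / r (B w) +
      \sum_w sqn (k0 (B w)) / r (B w)) + M * (eta * (\sum_w sqn (k (B w)) / r (B w)) +
      (\sum_w sqn (u w) / r (B w)) / eta).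
    rewrite -big_split /= [eta * _]mulr_sumr mulr_suml -big_split /= !mulr_sumr -big_split /=.
    by apply: eq_bigr => w _; rewrite /G; ring.
  apply: lerD.
    by rewrite mulrC ler_wpM2r //; lra.
  rewrite -mulrA ler_wpM2l // mulrDr mulr1 lerD //; first by rewrite ler_pM2l.
  by rewrite ler_pdivrMr // -expr2.
rewrite -(pair_bigA _ (fun i o => E (i, o))) /=.
under eq_bigr do rewrite sum_option /E /=.
rewrite big_split /= -mulr_sumr big_split /= -!mulr_sumr -mulr_suml -/V.
have -> : \sum_i r (B (i, None)) = r (Rm m).
  rewrite (rmass_split sY (splitting_meas sX None)); apply: eq_bigr => i _.
  by rewrite /B setIC.
rewrite mulrDr sumr_const -[#|_|]/#|I| -mulr_natl -/n.
have : M * (a * (C * r (Rm m))) <= e / 3.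
  move: mP; rewrite ler_pdivlMr // => h; apply: le_trans h.
  have := rmass_ge0 rho (Rm m); nra.
have : n * (c * \sum_(i < m) (q i - p i)) <= e / 3.
  have : n * (c * \sum_(i < m) (q i - p i)) <= n * (c * d) by rewrite !ler_wpM2l.
  move=> /le_trans; apply; rewrite /d !mulrA ler_pdivrMr; last first.
    by apply: ltr_wpDl => //; exact: mulr_ge0.
  lra.
lra.
Qed.

End singular_commutator.

Section singular_commutator_limit.
Context {R : realType}.
Variable (K : hilbert R) (rho : {measure set (measurableTypeR R) -> \bar R}).
Hypothesis rho_fin : (rho setT < +oo)%E.
Local Notation T := (measurableTypeR R).
Local Notation r := (rmass rho).
Implicit Types k : set T -> K.

Lemma nullseq_sum (I : finType) (u : I -> nat -> R) :
  (forall i, nullseq (u i)) -> nullseq (fun n => \sum_i u i n).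
Proof.
move=> u0 e e0.
have e1 : 0 < e / (#|I|%:R + 1) by rewrite divr_gt0 // ltr_wpDl.
have /choice[N NP] : forall i, exists N, forall n, (N <= n)%N ->
    u i n <= e / (#|I|%:R + 1) by move=> i; exact: u0.
exists (\max_i N i) => n nN.
apply: (@le_trans _ _ (\sum_(i in I) e / (#|I|%:R + 1))).
  by apply: ler_sum => i _; apply: NP; exact: leq_trans (leq_bigmax i) nN.
rewrite sumr_const -[leLHS]mulr_natr mulrAC ler_pdivrMr ?ltr_wpDl // ler_pM2l //.
by rewrite lerDl.
Qed.

(** If the form were positive at [k0 setT], convexity would bound it below on every splitting [Y].
    On a finite splitting one copy of [k0] may be replaced by [k n], and then the commutator
    estimate makes the sum too small. *)
Lemma singular_commutator_limit (C M : R) (Z : set T) (k : nat -> set T -> K)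
    (k0 : set T -> K) (L : {linear K -> K}) (D : nat -> K -> K) :
  0 < C -> 0 < M ->
  lebesgue_measure Z = 0%E -> rho (~` Z) = 0%E -> measurable Z ->
  (forall n, l2_bounded rho C (k n)) -> l2_bounded rho C k0 ->
  (forall X, measurable X -> nullseq (fun n => sqn (k n X - k0 X))) ->
  (forall x, 0 <= rip (L x) x) ->
  (forall x y a, 0 < a -> `|rip (L x) y| <= M * (a * sqn x + sqn y / a)) ->
  (forall e, 0 < e -> exists N, forall n, (N <= n)%N ->
    forall x y, `|rip (D n x) y - rip (L x) y| <= e * (sqn x + sqn y)) ->
  (forall n, exists2 c, 0 <= c & forall (a b : R) (X : set T), a <= b ->
    measurable X -> X `<=` `[a, b] ->
    `|rip (D n (k n X)) (k0 X)| <= c * (b - a) * r X) ->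
  rip (L (k0 setT)) (k0 setT) <= 0.
Proof.
move=> C0 M0 Z0 rZ mZ kb k0b kk0 L0 LM DL Dc.
rewrite leNgt; apply/negP => q0.
have rT : 0 < r setT.
  rewrite lt0r rmass_ge0 andbT; apply/eqP => z; move: q0.
  by rewrite (l2_bounded_null k0b measurableT z) rip0r ltxx.
pose q := rip (L (k0 setT)) (k0 setT) / r setT.
have qp : 0 < q by rewrite divr_gt0.
(* With this [eta] and [e1] below, the estimate yields [q / 4 + q / 4]; replacing [k0] by [k n]
   costs [q / 8 + q / 8]. The total is less than [q]. *)
pose eta := q / (4 * M * (C + 1)).
have C1 : 0 < C + 1 by rewrite addr_gt0.
have eta0 : 0 < eta by rewrite divr_gt0 // !mulr_gt0.
(* [Y] is near-optimal for [k0] alone, so [n] can still be chosen depending on [Y]. *)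
have [I [Y [sY Ydef]]] := near_optimal_splitting k0b (exprn_gt0 2 eta0).
have mY := splitting_meas sY.
pose v i := (r (Y i))^-1%:C *: k0 (Y i).
pose V := \sum_i sqn (v i).
have V0 : 0 <= V by apply: sumr_ge0 => i _; exact: rip_ge0.
pose e1 := q / (8 * C).
have e10 : 0 < e1 by rewrite divr_gt0 // mulr_gt0.
pose a := (M * V + 1) / (q / 8).
have q8 : 0 < q / 8 by rewrite divr_gt0.
have MV0 : 0 <= M * V by apply: mulr_ge0 => //; exact: ltW.
have a0 : 0 < a by rewrite divr_gt0 // ltr_wpDl.
have Va : M * (V / a) <= q / 8.
  rewrite mulrA ler_pdivrMr // [leRHS]mulrC /a divfK ?gt_eqF //.
  by rewrite lerDl.
have g0 : 0 < q / (8 * M * a).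
  by apply: divr_gt0 => //; apply: mulr_gt0 => //; apply: mulr_gt0.
have [N1 N1P] := DL _ e10.
have [N2 N2P] := nullseq_sum (fun i => kk0 _ (mY i)) g0.
pose n := maxn N1 N2.
have [c c0 cP] := Dc n.
have est := singular_commutator_estimate rho_fin C0 (ltW M0) c0 eta0 (ltW e10)
  Z0 rZ mZ (kb n) k0b sY LM (N1P n (leq_maxl _ _)) cP Ydef.
have diff := N2P n (leq_maxr _ _).
have := energy_convex rho_fin k0b sY L0 rT; rewrite -/q.
have -> : \sum_i rip (L (k0 (Y i))) (k0 (Y i)) / r (Y i) =
    \sum_i rip (L (k n (Y i))) (v i) - \sum_i rip (L (k n (Y i) - k0 (Y i))) (v i).
  rewrite -sumrB; apply: eq_bigr => i _.
  have -> : L (k n (Y i) - k0 (Y i)) = L (k n (Y i)) - L (k0 (Y i)) by exact: linearB.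
  by rewrite ripBl subKr ripZr mulrC.
have h : - (\sum_i rip (L (k n (Y i) - k0 (Y i))) (v i)) <=
    M * (a * (\sum_i sqn (k n (Y i) - k0 (Y i))) + V / a).
  rewrite mulr_sumr /V mulr_suml -big_split /= mulr_sumr -sumrN.
  apply: ler_sum => i _; have := LM (k n (Y i) - k0 (Y i)) (v i) _ a0.
  by rewrite ler_norml lerNl => /andP[].
have h2 : M * (a * (\sum_i sqn (k n (Y i) - k0 (Y i)))) <= q / 8.
  have p0 : 0 < 8 * M * a by apply: mulr_gt0 => //; apply: mulr_gt0.
  by rewrite ler_pdivlMr //; move: diff; rewrite ler_pdivlMr //; lra.
have h3 : 2 * C * e1 = q / 4 by rewrite /e1; field; rewrite gt_eqF.
have h4 : M * eta * (C + 1) = q / 4.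
  by rewrite /eta; field; rewrite !gt_eqF.
move: est h; rewrite h3 h4 mulrDr; lra.
Qed.

End singular_commutator_limit.

(** * Domination between measures *)

Section lebesgue_domination.
Context {R : realType}.
Local Notation T := (measurableTypeR R).
Implicit Types mu nu : {measure set T -> \bar R}.

Lemma measure_bigcup_eq0 mu (F : nat -> set T) :
  (forall n, measurable (F n)) -> (forall n, mu (F n) = 0%E) ->
  mu (\bigcup_n F n) = 0%E.
Proof.
move=> mF F0; apply: measure_negligible; first exact: bigcup_measurable.
by apply: negligible_bigcup => n; exists (F n); split.
Qed.

(** [N] is the negative set in a Hahn decomposition of the charge [mu - n * nu]. *)
Lemma hahn_domination mu nu (n : nat) :
  (mu setT < +oo)%E -> (nu setT < +oo)%E ->
  exists N : set T, [/\ measurable N,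
    forall X, measurable X -> X `<=` N -> (mu X <= n%:R%:E * nu X)%E &
    forall X, measurable X -> X `<=` ~` N -> (n%:R%:E * nu X <= mu X)%E].
Proof.
move=> muoo nuoo.
pose c1 := charge_of_finite_measure (mfrestr measurableT muoo).
pose c2 := charge_of_finite_measure (mfrestr measurableT nuoo).
pose c := cadd c1 (cscale (- n%:R) c2).
have [P [N [[mP pP] [mN nN] PN PN0]]] := Hahn_decomposition c.
have cE X : measurable X -> c X = (mu X - n%:R%:E * nu X)%E.
  move=> mX; rewrite /c /cadd /= /cscale /c1 /c2 /charge_of_finite_measure.
  rewrite /mfrestr /mrestr setIT EFinN mulNe; congr (_ - _ * _)%E.
  by rewrite -[RHS](congr1 nu (setIT X)).
have fin X : measurable X -> (n%:R%:E * nu X)%E \is a fin_num.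
  move=> mX; rewrite fin_numM // ge0_fin_numE //.
  by apply: (le_lt_trans _ nuoo); apply: le_measure; rewrite ?inE.
exists N; split => // X mX XN.
  by have : (c X <= 0)%E := nN X mX XN; rewrite cE // sube_le0.
have XP : X `<=` P by move=> x /XN nNx; have : (P `|` N) x by [rewrite PN]; case.
by have : (0 <= c X)%E := pP X mX XP; rewrite cE // sube_ge0 // fin.
Qed.

(** The Hahn sets [N n] are [mu]-null by hypothesis. Off their union [n * nu <= mu] for every [n],
    and [mu] is finite, so [nu] vanishes there. *)
Lemma singular_of_no_domination mu nu :
  (mu setT < +oo)%E -> (nu setT < +oo)%E ->
  (forall n S, measurable S ->
    (forall X, measurable X -> X `<=` S -> (mu X <= n%:R%:E * nu X)%E) -> mu S = 0%E) ->
  mutually_singular mu nu.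
Proof.
move=> muoo nuoo h.
have /choice[N NP] := fun n => hahn_domination n muoo nuoo.
have mN n : measurable (N n) by case: (NP n).
have muN n : mu (N n) = 0%E by case: (NP n) => _ + _; exact: h.
exists (\bigcup_n N n); split.
- exact: bigcup_measurable.
- exact: measure_bigcup_eq0.
- set Q := ~` _; have mQ : measurable Q by apply: measurableC; exact: bigcup_measurable.
  have le n : (n%:R%:E * nu Q <= mu setT)%E.
    apply: (@le_trans _ _ (mu Q)); last by apply: le_measure; rewrite ?inE.
    have [_ _] := NP n; apply => //.
    by apply: subsetC => x Nx; exists n.
  have nuQ : nu Q \is a fin_num.
    rewrite ge0_fin_numE //.
    by apply: (le_lt_trans _ nuoo); apply: le_measure; rewrite ?inE.
  have muT : mu setT \is a fin_num by rewrite ge0_fin_numE.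
  apply/eqP; rewrite eq_le measure_ge0 andbT leNgt; apply/negP => Q0.
  have q0 : 0 < fine (nu Q) by rewrite fine_gt0 // Q0 -ge0_fin_numE.
  have := le (Num.truncn (fine (mu setT) / fine (nu Q))).+1.
  rewrite -(fineK nuQ) -(fineK muT) -EFinM lee_fin leNgt => /negP; apply.
  by rewrite -ltr_pdivrMr // truncnS_gt.
Qed.

Definition symmetric_itv (m : nat) : set T := `[- m%:R, m%:R]%classic.

Lemma measurable_symmetric_itv m : measurable (symmetric_itv m).
Proof. exact: measurable_itv. Qed.

(** The restrictions of [sigma] to compact intervals are finite. If none dominated [mu] up to a
    factor on a set of positive [mu]-mass, [mu] would be singular to each of them, and the union of
    the separating sets would separate [mu] from [sigma]. *)
Lemma radon_not_singular mu (sigma : {measure set T -> \bar R}) :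
  (mu setT < +oo)%E -> radon sigma -> ~ mutually_singular mu sigma ->
  exists (m n : nat) (S : set T), [/\ measurable S, mu S != 0%E &
    forall X, measurable X -> X `<=` S ->
      (mu X <= n%:R%:E * sigma (X `&` symmetric_itv m))%E].
Proof.
move=> muoo rs; apply: contra_notP => h.
have mD := measurable_symmetric_itv.
have /choice[N NP] : forall m : nat, exists N, [/\ measurable N, mu N = 0%E &
    mrestr sigma (mD m) (~` N) = 0%E].
  move=> m; apply: (@singular_of_no_domination mu (mrestr sigma (mD m))) => //.
    rewrite /= /mrestr setTI; apply: rs; exact: segment_compact.
  move=> n S mS le; apply/eqP; apply: contrapT => /negP S0; apply: h.
  by exists m, n, S.
exists (\bigcup_m N m); split.
- by apply: bigcup_measurable => m _; case: (NP m).
- by apply: measure_bigcup_eq0 => m; case: (NP m).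
- have mC : measurable (~` \bigcup_m N m).
    by apply: measurableC; apply: bigcup_measurable => m _; case: (NP m).
  have -> : ~` (\bigcup_m N m) =
      \bigcup_m (~` (\bigcup_m N m) `&` symmetric_itv m).
    rewrite -setI_bigcupr; apply/esym/setIidPl => x _.
    exists (Num.truncn `|x|).+1 => //; rewrite /symmetric_itv /= in_itv /= -ler_norml.
    by rewrite ltW // truncnS_gt.
  apply: measure_bigcup_eq0 => m; first exact: measurableI.
  apply/eqP; rewrite eq_le measure_ge0 andbT.
  have [mN _ <-] := NP m; rewrite /mrestr; apply: le_measure; rewrite ?inE.
  + exact: measurableI.
  + by apply: measurableI => //; exact: measurableC.
  + by apply: setSI; apply: subsetC => x Nx; exists m.
Qed.

End lebesgue_domination.

(** * The exceptional set *)

Section bounded_operators.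
Context {R : realType}.
Variables (H K : hilbert R).

Lemma continuous_sqn_bound (T : {linear H -> K}) : continuous T ->
  exists2 M : R, 0 < M & forall x, sqn (T x) <= M ^+ 2 * sqn x.
Proof.
move=> /linear_bounded_continuous/linear_boundedP/pinfty_ex_gt0[M M0 TM].
have MR : M = (complex.Re M)%:C by rewrite RRe_real // gtr0_real.
have m0 : 0 < complex.Re M by rewrite -ltcR -MR.
exists (complex.Re M) => // x; have := TM x; rewrite MR !normE -rmorphM lecR => h.
rewrite /sqn -(sqr_sqrtr (rip_ge0 (T x))) -(sqr_sqrtr (rip_ge0 x)) -exprMn.
by rewrite ler_sqr ?nnegrE ?sqrtr_ge0 // mulr_ge0 ?sqrtr_ge0 // ltW.
Qed.

(** The bound [M] makes the supremum genuine. Real homogeneity suits the difference quotients, which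
    carry no linear structure. *)
Lemma opnorm_sqn (T : H -> K) (M : R) :
  (forall (c : R) x, T (c%:C *: x) = c%:C *: T x) ->
  0 <= M -> (forall x, sqn (T x) <= M ^+ 2 * sqn x) ->
  0 <= opnorm T /\ forall x, sqn (T x) <= opnorm T ^+ 2 * sqn x.
Proof.
move=> TZ M0 TM.
pose S : set R := [set complex.Re `|T x| | x in [set x : H | `|x| <= 1]].
have T0 : T 0 = 0 by rewrite -(scaler0 _ (0 : R)%:C) TZ scale0r.
have S0 : S 0 by exists 0; rewrite /= ?normr0 ?T0 ?normr0.
have ubS : has_ubound S.
  exists M => _ [x x1 <-]; rewrite normE /=.
  have x1' : sqn x <= 1.
    by move: x1 => /=; rewrite -[1]/((1 : R)%:C) rip_sqr_le // expr1n.
  rewrite -[M]ger0_norm // -sqrtr_sqr ler_wsqrtr // (le_trans (TM x)) //.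
  by rewrite -[leRHS]mulr1 ler_wpM2l // sqr_ge0.
have Sop y : S y -> y <= opnorm T.
  by move=> Sy; apply: (@sup_upper_bound _ S _ y Sy); split; [exists 0|].
have op0 : 0 <= opnorm T by exact: Sop.
split=> // x; have [x0|x0] := eqVneq x 0; first by rewrite x0 T0 /sqn !rip0l mulr0.
have xp : 0 < sqn x by rewrite lt0r rip_ge0 andbT rip_eq0.
pose c := Num.sqrt (sqn x); have cp : 0 < c by rewrite sqrtr_gt0.
have cE : c ^+ 2 = sqn x by rewrite sqr_sqrtr // ltW.
have : Num.sqrt (sqn (T ((c^-1)%:C *: x))) <= opnorm T.
  apply: Sop; exists ((c^-1)%:C *: x); last by rewrite normE.
  rewrite /= -[1]/((1 : R)%:C) rip_sqr_le // ripZl ripZr -/(sqn x) -cE expr1n.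
  rewrite [leLHS](_ : _ = 1) //; field; by rewrite gt_eqF.
rewrite -ler_sqr ?nnegrE ?sqrtr_ge0 // sqr_sqrtr ?rip_ge0 //.
rewrite TZ /sqn ripZl ripZr mulrA -expr2 exprVn -[_ ^+ 2]/(c ^+ 2) cE.
by rewrite mulrC ler_pdivrMr.
Qed.

(** Cauchy-Schwarz, then Young's inequality with weight [a]. *)
Lemma sqn_bilinear (x y : K) (u : H) (M a : R) : 0 <= M -> 0 < a ->
  sqn x <= M ^+ 2 * sqn u ->
  `|rip x y| <= M * (a * sqn u + sqn y / a).
Proof.
move=> M0 a0 xM.
have h : rip x y ^+ 2 <= (M * (a * sqn u + sqn y / a)) ^+ 2.
  apply: (le_trans (rip_cs _ _)).
  apply: (@le_trans _ _ (M ^+ 2 * sqn u * sqn y)).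
    by rewrite ler_wpM2r // rip_ge0.
  rewrite exprMn -mulrA ler_wpM2l ?sqr_ge0 //.
  have u0 : 0 <= a * sqn u by rewrite mulr_ge0 ?rip_ge0 // ltW.
  have y0 : 0 <= sqn y / a by rewrite divr_ge0 ?rip_ge0 // ltW.
  have -> : sqn u * sqn y = (a * sqn u) * (sqn y / a) by field; rewrite gt_eqF.
  by move: u0 y0; nra.
rewrite -(@ler_sqr R) ?nnegrE // ?real_normK ?num_real //.
by rewrite mulr_ge0 // addr_ge0 // ?mulr_ge0 ?invr_ge0 ?rip_ge0 // ltW.
Qed.

End bounded_operators.

(** * Cyclicity under the perturbation *)

Section cyclicity.
Context {R : realType}.
Variables (H K : hilbert R) (A : {linear H -> H}) (B : {linear K -> H})
  (Bs : {linear H -> K}) (G : {linear K -> K}).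
Hypotheses (Asa : self_adjoint A) (adjB : adjoint B Bs) (Gsa : self_adjoint G).

Definition perturbed x := A x + B (G (Bs x)).

Lemma perturbedD : {morph perturbed : x y / x + y}.
Proof.
move=> x y; rewrite /perturbed.
have -> : Bs (x + y) = Bs x + Bs y by exact: linearD.
have -> : G (Bs x + Bs y) = G (Bs x) + G (Bs y) by exact: linearD.
have -> : B (G (Bs x) + G (Bs y)) = B (G (Bs x)) + B (G (Bs y)) by exact: linearD.
have -> : A (x + y) = A x + A y by exact: linearD.
by rewrite addrACA.
Qed.

Lemma rip_selfadj (V : hilbert R) (S : {linear V -> V}) : self_adjoint S ->
  forall x y, rip (S x) y = rip x (S y).
Proof. by move=> Ssa x y; rewrite /rip Ssa. Qed.

Lemma perturbed_sa x y : rip (perturbed x) y = rip x (perturbed y).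
Proof.
rewrite /perturbed ripDl ripDr (rip_selfadj Asa); congr (_ + _).
by rewrite [LHS]ripC -!(rip_adj adjB) -(rip_selfadj Gsa) [LHS]ripC.
Qed.

Variable E : set (measurableTypeR R) -> {linear H -> H}.
Hypothesis ET : spectral_resolution E perturbed.
Hypothesis cycA : cyclic A (range B).

(** The orthogonal complement of all [E X f] contains the range of [B]. It is invariant under [A],
    because [A] and [perturbed] agree on the vectors [E X f]. By cyclicity it is the whole space, so
    [f] is orthogonal to itself. *)
Lemma cyclic_nonzero f : (forall X, measurable X -> Bs (E X f) = 0) -> f = 0.
Proof.
move=> BE0; have pE := ET.1.
(* The scalars [c] turn real orthogonality into complex orthogonality. *)
pose M := [set y | forall X, measurable X -> forall c : R[i], rip (c *: y) (E X f) = 0].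
suff MT : M = setT.
  have : M f by rewrite MT.
  move=> /(_ setT measurableT 1); rewrite scale1r (pvmT pE) => h.
  by apply/eqP; rewrite -rip_eq0 h.
apply: cycA.
- split.
  + move=> x cM X mX c; set u := E X f.
    set k := complex.Re (`|c| ^+ 2).
    have k0 : 0 <= k by exact: Re_sqr_norm_ge0.
    apply/eqP; rewrite -sqrf_eq0 eq_le sqr_ge0 andbT.
    apply/ler_addgt0Pr => e e0; rewrite add0r.
    have p0 : 0 < k * rip u u + 1 by rewrite ltr_wpDl // mulr_ge0 // rip_ge0.
    have [w Mw xw] := closure_rip cM (divr_gt0 e0 p0).
    have -> : rip (c *: x) u = rip (c *: (x - w)) u.
      by rewrite scalerBr ripBl (Mw X mX) subr0.
    apply: (le_trans (rip_cs _ _)); rewrite ripZZ -/k mulrAC.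
    apply: (@le_trans _ _ (k * rip u u * (e / (k * rip u u + 1)))).
      by rewrite ler_wpM2l // mulr_ge0 // rip_ge0.
    by rewrite mulrCA ger_pMr // ler_pdivrMr // mul1r lerDl.
  + by move=> X mX c; rewrite scaler0 rip0l.
  + by move=> x y Mx My X mX c; rewrite scalerDr ripDl Mx // My // addr0.
  + by move=> c x Mx X mX d; rewrite scalerA Mx.
- move=> _ [y _ <-] X mX c.
  have -> : c *: B y = B (c *: y) by rewrite linearZ.
  by rewrite ripC -(rip_adj adjB) BE0 // rip0l.
- move=> y My X mX c.
  have -> : c *: A y = A (c *: y) by rewrite linearZ.
  rewrite (rip_selfadj Asa).
  have -> : A (E X f) = perturbed (E X f).
    rewrite /perturbed BE0 //.
    have -> : G 0 = 0 by exact: linear0.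
    have -> : B 0 = 0 by exact: linear0.
    by rewrite addr0.
  rewrite ripC; apply: (pvm_orthogonal pE perturbedD perturbed_sa ET) => Y mY.
  by rewrite -(pvmI pE) // ripC; apply: My; exact: measurableI.
Qed.

End cyclicity.

Lemma separable_sequence (R : realType) (K : hilbert R) : separable K ->
  exists d : nat -> K, forall x (e : R), 0 < e -> exists n, sqn (x - d n) <= e.
Proof.
move=> [D [cD dD]]; have /countable_injP[f fI] := cD.
exists (fun n => xget 0 [set x | D x /\ f x = n]) => x e e0.
have p0 : 0 < (Num.sqrt e)%:C :> R[i] by rewrite ltcR sqrtr_gt0.
have [||y [By Dy]] := dD (ball x (Num.sqrt e)%:C).
- by exists x; exact: ballxx.
- exact: ball_open.
exists (f y); case: xgetP => [z _ [Dz fz]|/(_ y)]; last by move=> /(_ (conj Dy erefl)).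
have -> : z = y by apply: fI; rewrite ?inE.
move: By; rewrite -ball_normE /= => /ltW.
by rewrite rip_sqr_le ?sqrtr_ge0 // sqr_sqrtr // ltW.
Qed.

Section exceptional_set.
Context {R : realType}.
Variables (H K : hilbert R) (A : {linear H -> H}) (B : {linear K -> H})
  (Bs : {linear H -> K}) (I : set R) (G G' : R -> {linear K -> K}).
Local Notation T := (measurableTypeR R).

Hypotheses (sepK : separable K) (Asa : self_adjoint A)
  (hsB : hilbert_schmidt B) (adjB : adjoint B Bs)
  (Gc : forall t, I t -> continuous (G t) /\ self_adjoint (G t))
  (G'c : forall t, I t -> continuous (G' t))
  (GC1 : C1_on I G G')
  (G'pos : forall t, I t -> positive_definite (G' t)).

(** [opnorm] is a true bound only on bounded operators, so the error [W] of the quotient is first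
    bounded crudely, and Cauchy-Schwarz follows. *)
Lemma difference_quotient_bound s (e : R) : I s -> 0 < e ->
  exists2 d : R, 0 < d & forall t, I t -> t <> s -> `|t - s| < d ->
    forall x y, `|rip (((t - s)^-1)%:C *: (G t x - G s x)) y - rip (G' s x) y| <=
      e * (sqn x + sqn y).
Proof.
move=> Is e0; have [/cvgrPdist_le /(_ _ e0)] := GC1 Is.
move=> /nbhs_ballP[d /= d0 dP] _; exists d => // t It ts tsd x y.
have hh : t - s != 0 by rewrite subr_eq0; apply/eqP.
have := dP (t - s); rewrite -ball_normE /= sub0r normrN => /(_ tsd hh).
rewrite sub0r normrN.
have -> : s + (t - s) = t by rewrite addrC subrK.
set W := fun x : K => _; move=> opW.
have [M1 M10 b1] := continuous_sqn_bound (Gc It).1.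
have [M2 M20 b2] := continuous_sqn_bound (Gc Is).1.
have [M3 M30 b3] := continuous_sqn_bound (G'c Is).
pose c := (t - s)^-1.
have WZ (a : R) z : W (a%:C *: z) = a%:C *: W z.
  rewrite /W.
  have -> : G t (a%:C *: z) = a%:C *: G t z by exact: linearZ.
  have -> : G s (a%:C *: z) = a%:C *: G s z by exact: linearZ.
  have -> : G' s (a%:C *: z) = a%:C *: G' s z by exact: linearZ.
  by rewrite -scalerBr scalerA mulrC -scalerA -scalerBr.
pose N2 := 4 * c ^+ 2 * (M1 ^+ 2 + M2 ^+ 2) + 2 * M3 ^+ 2.
have N20 : 0 <= N2.
  apply: addr_ge0; last by apply: mulr_ge0 => //; exact: sqr_ge0.
  apply: mulr_ge0; first by apply: mulr_ge0 => //; exact: sqr_ge0.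
  by apply: addr_ge0; exact: sqr_ge0.
have Wb z : sqn (W z) <= Num.sqrt N2 ^+ 2 * sqn z.
  rewrite sqr_sqrtr // /W; set u := G t z; set v := G s z; set w := G' s z.
  have h1 := sqnB_le (c%:C *: (u - v)) w; rewrite sqnZ in h1.
  have h2 : c ^+ 2 * sqn (u - v) <= c ^+ 2 * (2 * sqn u + 2 * sqn v).
    by rewrite ler_wpM2l ?sqr_ge0 // sqnB_le.
  have h3 : c ^+ 2 * sqn u <= c ^+ 2 * (M1 ^+ 2 * sqn z).
    by rewrite ler_wpM2l ?sqr_ge0 // b1.
  have h4 : c ^+ 2 * sqn v <= c ^+ 2 * (M2 ^+ 2 * sqn z).
    by rewrite ler_wpM2l ?sqr_ge0 // b2.
  have := b3 z; rewrite -/w /N2; lra.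
have [op0 nP] := opnorm_sqn WZ (sqrtr_ge0 _) Wb.
have We : sqn (W x) <= e ^+ 2 * sqn x.
  apply: (le_trans (nP x)); rewrite ler_wpM2r ?rip_ge0 //.
  rewrite ler_sqr ?nnegrE ?(ltW e0) //.
  exact: le_trans (ler_norm _) opW.
rewrite -ripBl; have := sqn_bilinear y (ltW e0) ltr01 We.
by rewrite mul1r divr1.
Qed.

Variables (rho : {measure set T -> \bar R}) (Z : set T).
Hypotheses (rho_fin : (rho setT < +oo)%E) (mZ : measurable Z)
  (Z0 : lebesgue_measure Z = 0%E) (rhoZ : rho (~` Z) = 0%E).
Local Notation r := (rmass rho).
Local Notation Tp t := (perturbed A B Bs (G t)).

(** A witness [(E, f)] of non-singularity: [E X] being a projection, [sqn (E X f)] is the scalar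
    spectral measure of [f]. *)
Definition dominated_vector t (p : (set T -> {linear H -> H}) * H) :=
  [/\ spectral_resolution p.1 (Tp t), Bs p.2 <> 0 &
    forall X, measurable X -> sqn (p.1 X p.2) <= r X].

(** Over disjoint cells the vectors [E (Y i) f] are orthogonal, with squared norms at most
    [r (Y i)], so [hilbert_schmidt_bound] applies with one constant for all [t]. A single cell gives
    the second clause. *)
Lemma dominated_vector_l2_bounded : exists2 C : R, 0 < C & forall t p,
  dominated_vector t p -> l2_bounded rho C (fun X => Bs (p.1 X p.2)).
Proof.
have [C C0 CP] := hilbert_schmidt_bound hsB adjB.
exists C => // t [E f] /= [ET _ Ef]; have pE := ET.1; split.
- move=> X Y mX mY XY; rewrite (pvmU pE) //.
  exact: linearD.
- move=> X mX; have [z|nz] := eqVneq (r X) 0.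
    have /eqP : E X f == 0.
      by rewrite -rip_eq0 eq_le rip_ge0 andbT; have := Ef X mX; rewrite z.
    move=> ->; have -> : Bs 0 = 0 by exact: linear0.
    by rewrite /sqn rip0l z mulr0.
  rewrite -ler_pdivrMr; last by rewrite lt0r nz rmass_ge0.
  have := CP 'I_1 (fun=> E X f) (fun=> r X) _ (fun=> Ef X mX).
  by rewrite big_ord1; apply => i j; rewrite !ord1 eqxx.
- move=> J Y mY dY; apply: CP => [i j ij|i]; last exact: Ef.
  rewrite ripC -(pvm_rip pE) // -(pvmI pE) //.
  have /disj_set2P -> : [disjoint Y i & Y j] by exact: dY.
  by rewrite (pvm0 pE) rip0l.
Qed.

(** With [y = E X f] and [z = F X g], the left side is [rip (A_t y) z - rip y (A_s z)], as [A]
    cancels. Each term is within [(b - a) * r X] of [a * rip y z]. *)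
Lemma commutator_bound s t p q (a b : R) (X : set T) :
  I s -> I t -> dominated_vector t p -> dominated_vector s q ->
  a <= b -> measurable X -> X `<=` `[a, b] ->
  `|rip (G t (Bs (p.1 X p.2)) - G s (Bs (p.1 X p.2))) (Bs (q.1 X q.2))| <=
    2 * (b - a) * r X.
Proof.
case: p => E f; case: q => F g /= Is It [ET _ Ef] [FT _ Fg] ab mX Xab.
have pE := ET.1; have pF := FT.1.
set y := E X f; set z := F X g.
have y0 : sqn y <= r X by exact: Ef.
have z0 : sqn z <= r X by exact: Fg.
have -> : rip (G t (Bs y) - G s (Bs y)) (Bs z) = rip (Tp t y) z - rip (Tp s z) y.
  rewrite ripBl (ripC (Tp s z)) -(perturbed_sa Asa adjB (Gc Is).2) /perturbed !ripDl.
  rewrite ![rip _ (Bs z)]ripC !(rip_adj adjB) ![rip z _]ripC.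
  by rewrite opprD addrACA subrr add0r.
have yE : E X y = y by exact: (pvm_idem pE).
have zF : F X z = z by exact: (pvm_idem pF).
have := spectral_bilin_bound pE (@perturbedD _ _ _ A B Bs (G t))
  (perturbed_sa Asa adjB (Gc It).2) ET z ab mX Xab yE.
have := spectral_bilin_bound pF (@perturbedD _ _ _ A B Bs (G s))
  (perturbed_sa Asa adjB (Gc Is).2) FT y ab mX Xab zF.
rewrite [rip z y]ripC -/(sqn y) -/(sqn z).
have : (b - a) * ((sqn y + sqn z) / 2) <= (b - a) * r X.
  by rewrite ler_wpM2l ?subr_ge0 //; lra.
rewrite [sqn z + sqn y]addrC !ler_norml.
move=> h /andP[h1 h2] /andP[h3 h4]; apply/andP; split; lra.
Qed.

(** Otherwise condensation gives [t n -> s] with [t n <> s] and [k (t n) X -> k s X] on the line and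
    on rational rays, hence on all Borel sets. The limit lemma, applied to the difference quotients,
    contradicts the positivity of [G' s]. *)
Lemma exceptional_set_countable :
  countable [set t | I t /\ exists p, dominated_vector t p].
Proof.
apply: contrapT; set P := [set t | _] => nP.
have /choice[v vP] : forall t, exists p, P t -> dominated_vector t p.
  move=> t; have [[_ [p tp]]|nPt] := pselect (P t); first by exists p.
  by exists ((fun=> (idfun : {linear H -> H})), (0 : H)) => /nPt.
have [C C0 CP] := dominated_vector_l2_bounded.
pose k t X := Bs ((v t).1 X (v t).2).
have [d dP] := separable_sequence sepK.
pose q n : rat := odflt 0 (choice.unpickle n).
pose ray n : set T := `]ratr (q n), +oo[%classic.
(* Index 0 compares parameters, index 1 the vectors [k t setT], and index [i'.+2] the vectors on the
   [i']-th ray. *)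
pose W n i j : set R := [set t | match i with
  | 0%N => `|t - ratr (q j)| <= n.+1%:R^-1
  | 1%N => sqn (k t setT - d j) <= n.+1%:R^-1
  | i'.+2 => sqn (k t (ray i') - d j) <= n.+1%:R^-1
  end].
have WP n i t : exists j, W n i j t.
  have e0 : 0 < n.+1%:R^-1 :> R by rewrite invr_gt0.
  case: i => [|[|i]]; [|exact: dP..].
  have /rat_in_itvoo[x] : t < t + n.+1%:R^-1 by rewrite ltrDl.
  rewrite in_itv /= => /andP[tx xt]; exists (choice.pickle x).
  rewrite /W /= /q choice.pickleK /= distrC ger0_norm; last by rewrite subr_ge0 ltW.
  by rewrite lerBlDl ltW.
have [s Ps /choice[t tP]] := condensation WP nP.
have Is := Ps.1; have vs := vP _ Ps.
have It n : I (t n) by have [[]] := tP n.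
have vt n : dominated_vector (t n) (v (t n)) by have [+ _ _] := tP n; exact: vP.
have ts n : t n <> s by have [_ + _] := tP n.
have inv_null : nullseq (fun n => 4 * n.+1%:R^-1 : R).
  move=> e e0; exists (Num.truncn (4 / e)) => n nN.
  rewrite ler_pdivrMr // mulrC -ler_pdivrMr //.
  apply: ltW; apply: (lt_le_trans (truncnS_gt _)); by rewrite ler_nat.
have sqn_close (x y z : K) n : sqn (x - z) <= n.+1%:R^-1 -> sqn (y - z) <= n.+1%:R^-1 ->
    sqn (y - x) <= 4 * n.+1%:R^-1.
  have := sqnB_le (y - z) (x - z); rewrite opprB addrA subrK.
  move: (n.+1%:R^-1) => e; lra.
have tnull : nullseq (fun n => `|t n - s|).
  move=> e e0; have [N NP] := inv_null _ e0; exists N => n /NP; apply: le_trans.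
  have [_ _ /(_ 0%N isT)[j [h1 h2]]] := tP n.
  move: (h1 : `|s - ratr (q j)| <= _) (h2 : `|t n - ratr (q j)| <= _) => {h1 h2}.
  have := ler_distD (ratr (q j)) (t n) s; rewrite [ `|ratr _ - s|]distrC.
  have : 0 <= n.+1%:R^-1 :> R by rewrite invr_ge0.
  move: (n.+1%:R^-1) => e'; lra.
have knull X : measurable X -> nullseq (fun n => sqn (k (t n) X - k s X)).
  apply: (l2_bounded_cvg rho_fin C0 (fun n => CP _ _ (vt n)) (CP _ _ vs)).
    move=> e e0; have [N NP] := inv_null _ e0; exists (maxn N 1) => n.
    rewrite geq_max => /andP[/NP + n1]; apply: le_trans.
    by have [_ _ /(_ 1%N n1)[j [/= h1 h2]]] := tP n; exact: sqn_close h1 h2.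
  (* The ray starting at [x] has index [pickle x + 2], so it is controlled from that [n] on. *)
  move=> x e e0; have [N NP] := inv_null _ e0; exists (maxn N (choice.pickle x).+2) => n.
  rewrite geq_max => /andP[/NP + n1]; apply: le_trans.
  have [_ _ /(_ _ n1)[j [/= h1 h2]]] := tP n.
  by have := sqn_close _ _ _ _ h1 h2; rewrite /ray /q choice.pickleK.
have [M M0 MP] := continuous_sqn_bound (G'c Is).
have L0 x : 0 <= rip (G' s x) x.
  have [->|x0] := eqVneq x 0; first by rewrite rip0r.
  by have := G'pos Is x0; rewrite ltcE => /andP[_ /ltW].
have : rip (G' s (k s setT)) (k s setT) <= 0.
  apply: (singular_commutator_limit (D := fun n x =>
    ((t n - s)^-1)%:C *: (G (t n) x - G s x)) rho_fin C0 M0 Z0 rhoZ mZ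
    (fun n => CP _ _ (vt n)) (CP _ _ vs) knull L0).
  - by move=> x y a a0; exact: sqn_bilinear (ltW M0) a0 (MP x).
  - move=> e e0; have [dl dl0 dlP] := difference_quotient_bound Is e0.
    have [N NP] := tnull _ (divr_gt0 dl0 (ltr0n R 2)).
    exists N => n /NP nd; apply: dlP => //.
    by apply: (le_lt_trans nd); rewrite ltr_pdivrMr // ltr_pMr // ltr1n.
  (* This constant is not bounded in [n], which is harmless: intervals are chosen after [n]. *)
  - move=> n; exists (`|(t n - s)^-1| * 2); first by rewrite mulr_ge0.
    move=> a b X ab mX Xab; rewrite ripZl normrM -!mulrA ler_wpM2l // mulrA.
    exact: (commutator_bound Is (It n) (vt n) vs ab mX Xab).
have [vE fB _] := vs; rewrite /k (pvmT vE.1).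
have B0 : Bs (v s).2 != 0 by apply/eqP.
by have := G'pos Is B0; rewrite ltcE /= => /andP[_]; rewrite ltNge => /negP.
Qed.

End exceptional_set.

(** * Reduction to countably many finite measures *)

Section reduction.
Context {R : realType}.
Local Notation T := (measurableTypeR R).

Definition scaled_restriction (sigma : {measure set T -> \bar R}) (m n : nat) :=
  mscale (NngNum (ler0n R n)) (mrestr sigma (measurable_symmetric_itv m)).

Lemma scaled_restrictionE (sigma : {measure set T -> \bar R}) m n X :
  scaled_restriction sigma m n X = (n%:R%:E * sigma (X `&` symmetric_itv m))%E.
Proof. by []. Qed.

Lemma scaled_restriction_fin (sigma : {measure set T -> \bar R}) m n :
  radon sigma -> (scaled_restriction sigma m n setT < +oo)%E.
Proof.
move=> rs; rewrite scaled_restrictionE setTI lte_mul_pinfty //.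
by apply: rs; exact: segment_compact.
Qed.

(** Projecting [x] to a set [S] on which [mu] is dominated gives a nonzero vector; by cyclicity some
    further projection [E Y] is not annihilated by [Bs]. The resulting scalar measure is
    [mu (X]&[Y]&[S)], still dominated. *)
Lemma dominated_vector_exists (H K : hilbert R) (A : {linear H -> H})
    (B : {linear K -> H}) (Bs : {linear H -> K}) (G : R -> {linear K -> K}) (t : R)
    (sigma mu : {measure set T -> \bar R}) :
  self_adjoint A -> adjoint B Bs -> self_adjoint (G t) -> cyclic A (range B) ->
  radon sigma ->
  is_spectral_measure (perturbed A B Bs (G t)) mu -> ~ mutually_singular mu sigma ->
  exists m n p, dominated_vector A B Bs G (scaled_restriction sigma m n) t p.
Proof.
move=> Asa adjB Gsa cycA rs [E [x [ET _ muE]]] nsing; have pE := ET.1.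
have muE' X : measurable X -> mu X = (sqn (E X x))%:E.
  by move=> mX; rewrite muE // /sqn pvm_rip_idem.
have [|m [n [S [mS muS Sle]]]] := radon_not_singular _ rs nsing.
  by rewrite muE' ?ltry.
have [Y mY BY] : exists2 Y, measurable Y & Bs (E Y (E S x)) <> 0.
  apply: contrapT => nY; move: muS; rewrite muE' // => /eqP; apply.
  have -> : E S x = 0.
    apply: (cyclic_nonzero Asa adjB Gsa ET cycA) => X mX.
    by apply: contrapT => BX; apply: nY; exists X.
  by rewrite /sqn rip0l.
exists m, n, (E, E Y (E S x)); split => //= X mX.
have mXY : measurable (X `&` Y) by exact: measurableI.
have mXYS : measurable (X `&` Y `&` S) by exact: measurableI.
have mD := measurable_symmetric_itv (R := R) m.
rewrite -(pvmI pE) // -(pvmI pE) // -lee_fin -muE' // /rmass fineK; last first.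
  by apply: rmass_fin mX; exact: scaled_restriction_fin.
apply: (le_trans (Sle _ mXYS _)); first exact: subIsetr.
rewrite [leRHS](scaled_restrictionE sigma m n X) lee_wpmul2l ?lee_fin //.
apply: le_measure; rewrite ?inE; [exact: measurableI..|].
by apply: setSI; rewrite -setIA; exact: subIsetl.
Qed.

End reduction.

Theorem theorem1p8 (R : realType) (H K : hilbert R)
    (A : {linear H -> H}) (B : {linear K -> H}) (Bs : {linear H -> K})
    (I : set R) (G G' : R -> {linear K -> K})
    (sigma : {measure set (measurableTypeR R) -> \bar R}) :
  separable H -> separable K ->
  continuous A -> self_adjoint A ->
  hilbert_schmidt B -> adjoint B Bs ->
  open I -> is_interval I ->
  (forall t, I t -> continuous (G t) /\ self_adjoint (G t)) ->
  (forall t, I t -> continuous (G' t)) ->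
  C1_on I G G' ->
  (forall t, I t -> positive_definite (G' t) /\ boundedly_invertible (G' t)) ->
  radon sigma -> mutually_singular sigma lebesgue_measure ->
  cyclic A (range B) ->
  countable [set t | I t /\
    ~ forall mu : {measure set (measurableTypeR R) -> \bar R},
        is_spectral_measure (fun x => A x + B (G t (Bs x))) mu ->
        mutually_singular mu sigma].
Proof.
move=> _ sepK _ Asa hsB adjB _ _ Gc G'c GC1 G'pos rs [N [mN sN lN]] cycA.
(* The exceptional set is covered by one countable set for each pair of a cutoff and a factor. *)
pose F (mn : nat * nat) := [set t | I t /\
  exists p, dominated_vector A B Bs G (scaled_restriction sigma mn.1 mn.2) t p].
apply: (@sub_countable _ _ _ (\bigcup_mn F mn)).
  apply: subset_card_le => t [It /existsNP[mu /not_implyP[muT nsing]]].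
  have [m [n [p tp]]] :=
    dominated_vector_exists Asa adjB (Gc t It).2 cycA rs muT nsing.
  by exists (m, n) => //; split => //; exists p.
apply: bigcup_countable => // -[m n] _.
(* The complement of [N] is Lebesgue null and carries [sigma], so it serves as [Z]. *)
apply: (exceptional_set_countable sepK Asa hsB adjB Gc G'c GC1
  (fun t It => (G'pos t It).1) (scaled_restriction_fin _ _ rs)
  (measurableC mN) lN).
rewrite [LHS](scaled_restrictionE sigma m n) setCK.
have -> : sigma (N `&` symmetric_itv m) = 0%E.
  apply/eqP; rewrite eq_le measure_ge0 andbT -sN; apply: le_measure; rewrite ?inE //.
  by apply: measurableI => //; exact: measurable_symmetric_itv.
by rewrite mule0.
Qed.
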